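(* Let $X, X_1,X_2,\dots$ be i.i.d. nonnegative real random variables with distribution function $F$ and right endpoint $x^*>0$ (possibly $x^*=\infty$). Suppose that $\mathsf{E}[X]=\int_0^\infty x\,dF(x)<\infty$ and that $F\in\mathsf{MDA}(G_\xi)$ for some $\xi<1$. Let $a(\cdot)$ be a positive measurable function such that $$\lim_{t\to\infty}\frac{U(tx)-U(t)}{a(t)}=\frac{x^\xi-1}{\xi},\qquad x>0,$$ where the right-hand side is interpreted as $\log x$ if $\xi=0$. Then the following statements are true. (i) If $0<\xi<1$, then $$\lim_{n\to\infty}\frac{1}{a(n)}\mathsf{E}[R_n(x)]=-\frac{\Gamma(-\xi)}{x},\qquad x>0,$$ where $a\in\mathcal{R}_\xi$. (ii) If $\xi=0$ and $x^*=\infty$, then $$\lim_{n\to\infty}\frac{1}{U(n)}\mathsf{E}[R_n(x)]=\frac1x,\qquad x>0,$$ where $U\in\mathcal{R}_0$. (iii) If $\xi=0$ and $x^*<\infty$, then for all $0<x<x^*$, $$\lim_{n\to\infty}\frac{1}{x^*-U(n)}\left(\frac{x^*-x}{x}-\mathsf{E}[R_n(x)]\right)=\frac1x,\qquad \lim_{n\to\infty}\frac{1}{x^*-U(n)}\mathsf{E}[\Delta_n(x)]=\frac{1}{x^*},$$ where $U(t)=x^*-L(t)$ for some $L\in\mathcal{R}_0$ such that $\lim_{t\to\infty}L(t)=0$. (iv) If $\xi<0$, then for all $0<x<x^*$, $$\lim_{n\to\infty}\frac{1}{a(n)}\left(\frac{x^*-x}{x}-\mathsf{E}[R_n(x)]\right)=\frac{\Gamma(-\xi)}{x},\qquad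 \lim_{n\to\infty}\frac{1}{a(n)}\mathsf{E}[\Delta_n(x)]=\frac{\Gamma(-\xi)}{x^*},$$ where $a\in\mathcal{R}_\xi$.
   Context: Notation. $\mathbb{N}=\{1,2,\dots\}$, $\mathbb{R}_+=[0,\infty)$, $(y)_+=\max(y,0)$. $F(x)=\mathsf{P}(X\le x)$ and $x^*=\sup\{x\in\mathbb{R}_+:F(x)<1\}$, assumed positive. $Z_n=\max(X_1,\dots,X_n)$. For $0<x<x^*$ and $n\in\mathbb{N}$, $$R_n(x)=\frac{(Z_n-x)_+}{x},\qquad \Delta_n(x)=\frac{x^*-\max(Z_n,x)}{x^*},$$ the latter being considered only when $x^*<\infty$. $U(t)=\inf\{x\in\mathbb{R}: 1/(1-F(x))\ge t\}$ for $t\ge1$ (with $1/0=+\infty$); only its values for large $t$ matter. $G_\xi(z)=\exp\{-(1+\xi z)_+^{-1/\xi}\}$, $z\in\mathbb{R}$, is the standard generalized extreme value distribution, with $(1+\xi z)_+^{-1/\xi}$ interpreted as $e^{-z}$ if $\xi=0$ (and $\exp\{-(+\infty)\}=0$). $F\in\mathsf{MDA}(G)$ means that there exist constants $a_n>0$, $b_n\in\mathbb{R}$ such that $\lim_{n\to\infty}\mathsf{P}((Z_n-b_n)/a_n\le z)=\lim_{n\to\infty}[F(a_nz+b_n)]^n=G(z)$ for every continuity point $z$ of $G$. It is a known fact that $F\in\mathsf{MDA}(G_\xi)$ is equivalent to the existence of a positive function $a(\cdot)$ as in the claim. $\Gamma$ is the gamma function (meromorphically continued). For $\alpha\in\mathbb{R}$,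 $\mathcal{R}_\alpha$ is the set of regularly varying functions with index $\alpha$: eventually positive measurable functions $f$ on $\mathbb{R}_+$ (only values at large arguments matter) with $\lim_{t\to\infty}f(ct)/f(t)=c^\alpha$ for all $c>0$; elements of $\mathcal{R}_0$ are called slowly varying. *)

(* Defs.v *)
From HB Require Import structures.
From mathcomp Require Import all_boot all_order all_algebra finmap.
From mathcomp Require Import all_classical all_reals all_analysis.
Import Order.TTheory GRing.Theory Num.Theory.
Import numFieldNormedType.Exports.

Set Implicit Arguments.
Unset Strict Implicit.
Unset Printing Implicit Defensive.

Local Open Scope classical_set_scope.
Local Open Scope ring_scope.

Definition independent_seq d (T : measurableType d) (R : realType)
    (P : probability T R) (X : nat -> {RV P >-> R}) : Prop :=
  forall (J : {fset nat}) (A : nat -> set R),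
    (forall i, i \in J -> measurable (A i)) ->
    P (\bigcap_(i in [set` J]) (X i @^-1` A i)) =
    (\big[*%E/1%E]_(i <- J) P (X i @^-1` A i))%E.

Definition identically_distributed d (T : measurableType d) (R : realType)
    (P : probability T R) (X : nat -> {RV P >-> R}) : Prop :=
  forall (i j : nat) (A : set R), measurable A ->
    distribution P (X i) A = distribution P (X j) A.

(* x^*; the value is -oo when no x >= 0 satisfies F x < 1. *)
Definition right_endpoint (R : realType) (F : R -> R) : \bar R :=
  ereal_sup [set x%:E | x in [set x : R | 0 <= x /\ F x < 1]].

(* U; the reciprocal is taken in \bar R, where 0^-1 = +oo.  The set is
   nonempty and bounded below when F is a distribution function and t > 1; for
   smaller t the value is the default value of [inf]. *)
Definition tail_quantile (R : realType) (F : R -> R) (t : R) : R :=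
  inf [set x : R | (t%:E <= (1 - F x)%:E^-1)%E].

(* Z_n = max(X_1, ..., X_n).  The index 0 is not used (X 0 plays the role of
   the generic variable X), and the default value X_1 is irrelevant for
   n >= 1. *)
Definition running_max d (T : measurableType d) (R : realType)
    (P : probability T R) (X : nat -> {RV P >-> R}) (n : nat) (w : T) : R :=
  \big[Num.max/X 1%N w]_(1 <= i < n.+1) X i w.

Definition overshoot d (T : measurableType d) (R : realType)
    (P : probability T R) (X : nat -> {RV P >-> R}) (n : nat) (x : R)
    (w : T) : R :=
  Num.max (running_max X n w - x) 0 / x.

Definition endpoint_gap d (T : measurableType d) (R : realType)
    (P : probability T R) (X : nat -> {RV P >-> R}) (xs : R) (n : nat) (x : R)
    (w : T) : R :=
  (xs - Num.max (running_max X n w) x) / xs.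

(* (1 + xi z)_+^(-1/xi) in [0, +oo], read as e^(-z) when xi = 0.  The case
   split is needed because 0 `^ r = 0 for negative r in the library. *)
Definition gev_exponent (R : realType) (xi z : R) : \bar R :=
  if xi == 0 then (expR (- z))%:E
  else let y := Num.max (1 + xi * z) 0 in
       if (y == 0) && (0 < xi) then +oo%E else (y `^ (- xi^-1))%:E.

Definition gev (R : realType) (xi z : R) : R :=
  fine (expeR (- gev_exponent xi z)%E).

Definition MDA (R : realType) (F G : R -> R) : Prop :=
  exists a b : nat -> R, (forall n, 0 < a n) /\
    forall z : R, {for z, continuous G} ->
      F (a n * z + b n) ^+ n @[n --> \oo] --> G z.

(* (x^xi - 1) / xi, read as log x when xi = 0. *)
Definition box_cox (R : realType) (xi x : R) : R :=
  if xi == 0 then ln x else (x `^ xi - 1) / xi.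

Definition gamma_integral (R : realType) (s : R) : R :=
  \int[@lebesgue_measure R]_(t in `]0, +oo[) (t `^ (s - 1) * expR (- t)).

(* The restriction to the real line of the meromorphic continuation of
   Euler's integral, through Gamma s = Gamma (s + m) / (s (s+1) ... (s+m-1))
   with m = 0 if s > 0, and otherwise the least m such that s + m > 0.  The
   value at the poles 0, -1, -2, ... is a dummy one. *)
Definition Gamma (R : realType) (s : R) : R :=
  let m := if 0 < s then 0%N else (Num.truncn (- s)).+1 in
  gamma_integral (s + m%:R) / \prod_(k < m) (s + k%:R).

Definition regularly_varying (R : realType) (alpha : R) (f : R -> R) : Prop :=
  (exists M : R, measurable_fun `]M, +oo[ f /\ forall t, M < t -> 0 < f t) /\
  forall c : R, 0 < c -> f (c * t) / f t @[t --> +oo] --> c `^ alpha.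

(* Main.v *)
Require Import Defs.
From mathcomp Require Import all_boot all_order all_algebra finmap.
From mathcomp Require Import all_classical all_reals all_analysis measurable_realfun.
From mathcomp Require Import ring lra zify.
Import Order.TTheory GRing.Theory Num.Theory.
Import numFieldNormedType.Exports.

Local Open Scope classical_set_scope.
Local Open Scope ring_scope.

(**
Write U for the tail quantile function, Z_n for the maximum of the sample and
h for the limit (x^xi - 1)/xi.  The whole proof rests on one representation.
If S is a standard exponential variable, then exp (- S / n) has the law of the
n-th root of a uniform variable, so that U (1 / (1 - exp (- S / n))) has the
law F^n of Z_n.  Every mean in the statement is therefore an integral against
exp (- s) ds of a function of U, taken at a point lying between n / s and
n / s + 1 ([expectation_overshoot]).

The second ingredient is that the assumption on U forces plain regular
variation.  For c > 1 the defect e(t) = U(ct) - c^xi U(t) satisfies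
e(ct) - e(t) = o(U(ct) - U(t)), because h(c^2) - h(c) - c^xi h(c) = 0
([increment_defect_le]).  Both sides telescope along t, ct, c^2 t, ...
If U tends to infinity, summing upwards gives e = o(U), hence U(ct)/U(t) tends
to c^xi ([ext_rv_unbounded]); if U has a finite limit xs, summing to infinity
gives the same for xs - U ([ext_rv_bounded]).  Since U is nondecreasing, the
first case is possible only if xi >= 0 and the second only if xi <= 0.  When xi
is not 0, comparing U(2t) - U(t) with a(t) then gives U ~ a/xi, respectively
xs - U ~ - a/xi.

So U(n/s)/U(n), or (xs - U(n/s))/(xs - U(n)), tends to s^(-xi), and the limit
of the normalized means is the integral of s^(-xi) exp (- s), the value of
Euler's integral at 1 - xi, by dominated convergence.  The domination comes
from a Potter bound ([potter_bound]), valid for monotone regularly varying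
functions by iterating the doubling estimate.  For U the power of 1/s that it
produces is integrable at 0 because xi < 1; for xs - U the factor is a power of
s, harmless against exp (- s).  Writing everything in terms of
Gamma (- xi) uses the functional equation of Euler's integral.
*)

(** * Limits, powers and the exponential *)

Section Preliminaries.
Context {R : realType}.
Implicit Types (al c s t x xi : R).

Lemma cvg_near_eq {T : Type} {V : topologicalType} {G : set_system T} {FG : Filter G}
    (f g : T -> V) (l : V) :
  f x @[x --> G] --> l -> (\forall x \near G, f x = g x) -> g x @[x --> G] --> l.
Proof. by move=> fl fg; apply: cvg_trans fl; exact: near_eq_cvg. Qed.

Lemma near_pinfty_nat (S : set R) :
  (\forall t \near +oo, S t) -> \forall n \near \oo, S n%:R.
Proof.
move=> [M [_ MP]]; near=> n; apply: MP; near: n; exact: nbhs_infty_gtr.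
Unshelve. all: by end_near. Qed.

Lemma cvgy_mull c : 0 < c -> (c * t) @[t --> +oo] --> (+oo : set_system R).
Proof. by move=> c0; apply: gt0_cvgMry => //; exact: cvg_id. Qed.

Lemma pow_unbounded c x : 1 < c -> exists k : nat, x <= c ^+ k.
Proof.
move=> c1; have lc : 0 < ln c by rewrite ln_gt0.
have c0 : 0 < c by lra.
have /archi_boundP : 0 <= `|x| / ln c by rewrite divr_ge0 // ltW.
set k := Num.bound _ => kb; exists k.
rewrite (le_trans (ler_norm x))//.
have : `|x| <= k%:R * ln c by rewrite -ler_pdivrMr// ltW.
have -> : c ^+ k = expR (k%:R * ln c).
  by rewrite mulr_natl -lnXn// lnK// posrE exprn_gt0.
move=> /le_trans; apply; apply: le_trans (expR_ge1Dx _); lra.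
Qed.

Lemma cvg_powR al c : 0 < c -> x `^ al @[x --> c] --> c `^ al.
Proof.
move=> c0; suff : {for c, continuous (fun x : R => x `^ al)} by [].
apply/differentiable_continuous/derivable1_diffP.
by apply: derivable_powR; rewrite in_itv/= c0.
Qed.

Lemma powR_invl al s : 0 < s -> s^-1 `^ al = s `^ (- al).
Proof. by move=> s0; rewrite -(powR_inv1 (ltW s0)) -powRrM mulN1r. Qed.

Lemma powR2_lt1 xi : xi < 0 -> (2 : R) `^ xi < 1.
Proof. by move=> x0; rewrite /powR gt_eqF// expR_lt1 nmulr_rlt0// ln_gt0; lra. Qed.

Lemma powR2_gt1 xi : 0 < xi -> 1 < (2 : R) `^ xi.
Proof. by move=> x0; rewrite /powR gt_eqF// expR_gt1 pmulr_rgt0// ln_gt0; lra. Qed.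

Lemma continuous_expRN : continuous (fun s : R => expR (- s)).
Proof.
by move=> s; apply: continuous_comp; [exact: continuousN|exact: continuous_expR].
Qed.

Lemma is_derive_expRN s : is_derive s 1 (fun s : R => - expR (- s)) (expR (- s)).
Proof.
have := @is_deriveN _ _ _ (fun s : R => expR (- s)) s 1 (- expR (- s)).
rewrite opprK; apply; apply: is_derive_eq.
by rewrite mulrN1.
Qed.

Lemma measurable_expRN (D : set R) : measurable_fun D (fun s : R => expR (- s)).
Proof.
by apply/measurable_funTS; apply: measurableT_comp => //; exact: measurableT_comp.
Qed.

End Preliminaries.

(** * From extended to plain regular variation *)

Section RegularVariation.
Context {R : realType}.
Implicit Types (U a f : R -> R) (xi al c t x : R).

(** This cocycle identity is what makes the increments of U at different scales
comparable: it is the limiting form of splitting U(tcx) - U(t) at tc. *)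
Lemma box_coxM xi c x : 0 < c -> 0 < x ->
  box_cox xi (c * x) - box_cox xi c = c `^ xi * box_cox xi x.
Proof.
move=> c0 x0; rewrite /box_cox; case: eqVneq => [->|xi0].
  by rewrite powRr0 mul1r lnM ?posrE// addrC addKr.
rewrite powRM ?ltW//; field.
exact: xi0.
Qed.

Lemma box_cox_gt0 xi c : 1 < c -> 0 < box_cox xi c.
Proof.
move=> c1; have c0 : 0 < c by lra.
rewrite /box_cox; case: eqVneq => [_|xi0]; first by rewrite ln_gt0.
have E : c `^ xi = expR (xi * ln c) by rewrite /powR gt_eqF.
have lc : 0 < ln c by rewrite ln_gt0.
case: (ltP 0 xi) => xi1.
  by rewrite divr_gt0// subr_gt0 E -expR0 ltr_expR mulr_gt0.
have xi2 : xi < 0 by lra.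
by rewrite -mulrNN -invrN divr_gt0 ?oppr_gt0// subr_lt0 E -expR0 ltr_expR nmulr_rlt0.
Qed.

(** Extended regular variation in the sense of de Haan, with auxiliary function
[a]. *)
Definition ext_regularly_varying xi U a :=
  forall x, 0 < x -> (U (t * x) - U t) / a t @[t --> +oo] --> box_cox xi x.

(** U(2ct) - U(ct) is equivalent both to h(2) a(ct) and, when it is split at
t, to (h(2c) - h(c)) a(t) = c^xi h(2) a(t). *)
Lemma auxiliary_ratio_cvg xi U a : (forall t, 1 <= t -> 0 < a t) ->
  ext_regularly_varying xi U a ->
  forall c, 0 < c -> a (c * t) / a t @[t --> +oo] --> c `^ xi.
Proof.
move=> a0 HU c c0.
have h2 : 0 < box_cox xi 2 by apply: box_cox_gt0; lra.
pose f t : R := (U (c * t * 2) - U (c * t)) / a (c * t).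
pose g t : R := (U (t * (c * 2)) - U t) / a t - (U (t * c) - U t) / a t.
have A : f t @[t --> +oo] --> box_cox xi 2.
  have H := HU 2 (ltr0n _ _); apply: (cvg_comp _ _ (cvgy_mull c c0) H).
have B : g t @[t --> +oo] --> c `^ xi * box_cox xi 2.
  rewrite -box_coxM//; apply: cvgB; apply: HU => //.
  by rewrite mulr_gt0.
have AB : g t / f t @[t --> +oo] --> c `^ xi.
  rewrite -(mulfK (lt0r_neq0 h2) (c `^ xi)).
  by apply: cvgM => //; apply: cvgV => //; exact: lt0r_neq0.
apply: (cvg_near_eq _ _ _ AB); rewrite /g /f; near=> t.
have t1 : 1 <= t by near: t; apply: nbhs_pinfty_ge; exact: num_real.
have t2 : 1 <= c * t.
  rewrite -ler_pdivrMl//; near: t; apply: nbhs_pinfty_ge; exact: num_real.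
have at0 := a0 _ t1; have act0 := a0 _ t2.
have : (U (c * t * 2) - U (c * t)) / a (c * t) != 0.
  rewrite gt_eqF//; near: t; exact: (cvgr_gt _ A).
rewrite mulf_eq0 negb_or => /andP[Un0 _].
rewrite /= (_ : t * (c * 2) = c * t * 2); last by ring.
rewrite (_ : t * c = c * t); last by ring.
by field; rewrite Un0 !gt_eqF.
Unshelve. all: by end_near. Qed.

(** Divided by a(t), the left-hand side tends to h(c^2) - h(c) - c^xi h(c) = 0,
while (U(ct) - U(t)) / a(t) stays above h(c)/2.  The auxiliary function is
thus eliminated, and what remains telescopes along t, ct, c^2 t, ... *)
Lemma increment_defect_le xi U a c e : (forall t, 1 <= t -> 0 < a t) ->
  ext_regularly_varying xi U a -> 1 < c -> 0 < e ->
  \forall t \near +oo,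
    `| (U (c * (c * t)) - c `^ xi * U (c * t)) - (U (c * t) - c `^ xi * U t) |
      <= e * (U (c * t) - U t).
Proof.
move=> a0 HU c1 e0; have c0 : 0 < c by lra.
have hc := box_cox_gt0 xi c c1.
have A := HU c c0.
have B := HU (c * c) (mulr_gt0 c0 c0).
have /cvgrPdist_le C : (U (t * (c * c)) - U t) / a t - (U (t * c) - U t) / a t
    - c `^ xi * ((U (t * c) - U t) / a t)
    @[t --> +oo] --> 0.
  rewrite -[X in _ --> X](subrr (c `^ xi * box_cox xi c)) -[X in X - _]box_coxM//.
  by apply: cvgB; [exact: cvgB | apply: cvgM => //; exact: cvg_cst].
have ehc : 0 < e * (box_cox xi c / 2) by rewrite mulr_gt0// divr_gt0.
have {}C := C _ ehc.
near=> t.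
have t1 : 1 <= t by near: t; apply: nbhs_pinfty_ge; exact: num_real.
have at0 := a0 _ t1.
have H1 : box_cox xi c / 2 <= (U (t * c) - U t) / a t.
  by near: t; apply: (cvgr_ge _ A); lra.
have H2 : `|0 - ((U (t * (c * c)) - U t) / a t - (U (t * c) - U t) / a t
    - c `^ xi * ((U (t * c) - U t) / a t))| <= e * (box_cox xi c / 2).
  by near: t; exact: C.
have H3 : e * (box_cox xi c / 2) <= e * ((U (t * c) - U t) / a t).
  by rewrite ler_pM2l.
have {H2 H3} := le_trans H2 H3.
rewrite sub0r normrN [leRHS]mulrA ler_pdivlMr// -[X in _ * X](gtr0_norm at0) -normrM.
rewrite (_ : t * (c * c) = c * (c * t)); last by ring.
rewrite (_ : t * c = c * t); last by ring.
congr (`| _ | <= _); field.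
by rewrite gt_eqF.
Unshelve. all: by end_near. Qed.

Definition nondecreasing_gt1 U := forall s t, 1 < s -> s <= t -> U s <= U t.

(** The increment estimate, summed from a starting point in [t1, c t1] up to t,
bounds the defect E(t) by a constant plus e/2 U(t); the constant is absorbed
because U tends to infinity. *)
Lemma ext_rv_unbounded xi U a : (forall t, 1 <= t -> 0 < a t) ->
  nondecreasing_gt1 U -> (forall t, 1 < t -> 0 <= U t) ->
  ext_regularly_varying xi U a -> U t @[t --> +oo] --> +oo ->
  forall c, 1 < c -> U (c * t) / U t @[t --> +oo] --> c `^ xi.
Proof.
move=> a0 Und U0 HU Uy c c1; have c0 : 0 < c by lra.
apply/cvgrPdist_le => e e0.
have e20 : 0 < e / 2 by lra.
have [M [_ MP]] := increment_defect_le xi U a c _ a0 HU c1 e20.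
pose t1 := `|M| + 2.
have t1M : M < t1 by have := ler_norm M; rewrite /t1; lra.
have t11 : 1 < t1 by have := normr_ge0 M; rewrite /t1; lra.
pose E t := U (c * t) - c `^ xi * U t.
pose K := U (c * (c * t1)) + c `^ xi * U (c * t1).
have cx0 : 0 <= c `^ xi by exact: powR_ge0.
(* On the starting block [t1, c t1] the defect is bounded by monotonicity. *)
have base t : t1 <= t -> t <= c * t1 -> `|E t| <= K.
  move=> h1 h2; rewrite /E /K; apply: (le_trans (ler_normB _ _)).
  have ct1 : 1 < c * t by nra.
  rewrite normrM !ger0_norm ?U0//; last by lra.
  rewrite lerD ?ler_wpM2l// ?Und//; try lra.
  by rewrite ler_pM2l//.
have step k t : t1 <= t -> t <= c ^+ k * t1 -> `|E t| <= K + e / 2 * U t.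
  elim: k t => [|k IH] t h1 h2.
    have -> : t = t1 by lra.
    have := base t1 (lexx _); have := U0 _ t11; move=> ? /(_ _).
    have h : t1 <= c * t1 by nra.
    move=> /(_ h); nra.
  have [h|h] := leP t (c * t1).
    have := base t h1 h; have := U0 t (lt_le_trans t11 h1); nra.
  have k1 : t1 <= t / c by rewrite ler_pdivlMr// mulrC ltW.
  have k2 : t / c <= c ^+ k * t1.
    by rewrite ler_pdivrMr// mulrAC -exprSr.
  have := IH _ k1 k2.
  have := MP (t / c) (lt_le_trans t1M k1).
  have -> : c * (t / c) = t by rewrite mulrC divfK ?gt_eqF.
  rewrite -/(E t) (_ : U t - _ = E (t / c)); last first.
    by rewrite /E (_ : c * (t / c) = t)// mulrC divfK ?gt_eqF.
  have := ler_normD (E t - E (t / c)) (E (t / c)); rewrite subrK.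
  lra.
near=> t.
have tt1 : t1 <= t by near: t; apply: nbhs_pinfty_ge; exact: num_real.
have [k kP] := pow_unbounded c (t / t1) c1.
have t10 : 0 < t1 by lra.
have {}kP : t <= c ^+ k * t1 by rewrite -ler_pdivrMr.
have H := step k t tt1 kP.
have UK : 1 + 2 * K / e <= U t by near: t; move/cvgryPge : Uy; exact.
have K0 : 0 <= K by rewrite (le_trans (normr_ge0 _) (base t1 _ _))//; nra.
have Ke : 0 <= 2 * K / e by rewrite divr_ge0// ?mulr_ge0// ltW.
have Ut0 : 0 < U t by lra.
have KU : K <= e / 2 * U t.
  have : e / 2 * (2 * K / e) <= e / 2 * U t by rewrite ler_pM2l//; lra.
  suff -> : e / 2 * (2 * K / e) = K by [].
  field; lra.
rewrite distrC -(@ler_pM2r _ (U t))// -[X in _ * X <= _](gtr0_norm Ut0) -normrM.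
rewrite mulrBl divfK ?gt_eqF// -/(E t); lra.
Unshelve. all: by end_near. Qed.

(** The increment estimate is now summed from t to infinity: there the defect
vanishes, and the increments of U add up to at most xs - U(t).  That U stays
strictly below xs is forced by h(2) > 0. *)
Lemma ext_rv_bounded xi U a xs : (forall t, 1 <= t -> 0 < a t) ->
  (forall t, 1 < t -> U t <= xs) ->
  ext_regularly_varying xi U a -> U t @[t --> +oo] --> xs ->
  (\forall t \near +oo, U t < xs) /\
  forall c, 1 < c -> (xs - U (c * t)) / (xs - U t) @[t --> +oo] --> c `^ xi.
Proof.
move=> a0 Uxs HU Uy.
have UL : \forall t \near +oo, U t < xs.
  have h2 : 0 < box_cox xi 2 by apply: box_cox_gt0; lra.
  near=> t.
  have t1 : 1 < t by near: t; apply: nbhs_pinfty_gt; exact: num_real.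
  have : 0 < (U (t * 2) - U t) / a t by near: t; exact: (cvgr_gt _ (HU 2 (ltr0n _ _)) _ h2).
  rewrite pmulr_lgt0 ?invr_gt0 ?a0 ?ltW// subr_gt0 => /lt_le_trans; apply.
  by apply: Uxs; lra.
split=> // c c1; have c0 : 0 < c by lra.
apply/cvgrPdist_le => e e0.
have [M [_ MP]] := increment_defect_le xi U a c _ a0 HU c1 e0.
pose E t := (xs - U (c * t)) - c `^ xi * (xs - U t).
have E0 : E t @[t --> +oo] --> 0.
  rewrite -[X in _ --> X](_ : (xs - xs) - c `^ xi * (xs - xs) = 0); last by ring.
  apply: cvgB; first by apply: cvgB; [exact: cvg_cst | exact: cvg_comp (cvgy_mull c c0) Uy].
  by apply: cvgM; [exact: cvg_cst | apply: cvgB => //; exact: cvg_cst].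
have step k t : M < t -> 1 < t -> `|E t| <= `|E (c ^+ k * t)| + e * (U (c ^+ k * t) - U t).
  move=> tM t1; elim: k => [|k IH]; first by rewrite expr0 mul1r subrr mulr0 addr0.
  rewrite (le_trans IH)//.
  have ck : 1 <= c ^+ k by rewrite exprn_ege1// ltW.
  have ckt : t <= c ^+ k * t by nra.
  have := MP _ (lt_le_trans tM ckt); rewrite exprS -mulrA.
  set s := c ^+ k * t => {}IH.
  have : `|E s| <= `|E (c * s)| + `|E (c * s) - E s|.
    by rewrite -{1}(subKr (E (c * s)) (E s)) ler_normB.
  rewrite (_ : E (c * s) - E s =
      - (U (c * (c * s)) - c `^ xi * U (c * s) - (U (c * s) - c `^ xi * U s))).
    rewrite normrN; lra.
  rewrite /E; ring.
near=> t.
have tM : M < t by near: t; apply: nbhs_pinfty_gt; exact: num_real.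
have t1 : 1 < t by near: t; apply: nbhs_pinfty_gt; exact: num_real.
have Ut0 : 0 < xs - U t by rewrite subr_gt0; near: t; exact: UL.
rewrite distrC -(@ler_pM2r _ (xs - U t))// -[X in _ * X <= _](gtr0_norm Ut0) -normrM.
rewrite mulrBl divfK ?gt_eqF// -/(E t).
apply/ler_addgt0Pr => d d0.
have /cvgrPdist_le/(_ _ d0) [N [_ NP]] := E0.
have [k kP] := pow_unbounded c (`|N| + 1) c1.
have ckt : c ^+ k <= c ^+ k * t by rewrite ler_peMr ?exprn_ge0// ltW.
have ck1 : 1 <= c ^+ k by rewrite exprn_ege1// ltW.
have /NP/= : N < c ^+ k * t by have := ler_norm N; lra.
rewrite sub0r normrN => H.
have ckt1 : 1 < c ^+ k * t by nra.
have := step k t tM t1; have := Uxs _ ckt1.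
nra.
Unshelve. all: by end_near. Qed.

(** For c < 1 the ratio f(ct)/f(t) is the inverse of f(c^-1 u)/f(u) at u = ct. *)
Lemma ratio_cvg_gt0 al f : (\forall t \near +oo, 0 < f t) ->
  (forall c, 1 < c -> f (c * t) / f t @[t --> +oo] --> c `^ al) ->
  forall c, 0 < c -> f (c * t) / f t @[t --> +oo] --> c `^ al.
Proof.
move=> f0 H c c0; case: (ltgtP 1 c) => [/H//|c1|<-].
  have ci : 1 < c^-1 by rewrite invf_gt1.
  have A : f (c^-1 * (c * t)) / f (c * t) @[t --> +oo] --> c^-1 `^ al.
    exact: cvg_comp (cvgy_mull c c0) (H _ ci).
  have n0 : c^-1 `^ al != 0 by rewrite gt_eqF// powR_gt0 ?invr_gt0.
  have E : (c^-1 `^ al)^-1 = c `^ al.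
    by rewrite powR_invl// powRN invrK.
  have B : (f (c^-1 * (c * t)) / f (c * t))^-1 @[t --> +oo] --> (c^-1 `^ al)^-1 by exact: cvgV.
  rewrite E in B; apply: (cvg_near_eq _ _ _ B); near=> t.
  by rewrite /= mulrA mulVf ?gt_eqF// mul1r invf_div.
rewrite powR1; apply: cvg_near_cst; near=> t.
by rewrite mul1r divff// gt_eqF//; near: t.
Unshelve. all: by end_near. Qed.

End RegularVariation.

(** * Uniform bounds for monotone regularly varying functions *)

Section RegularlyVaryingBounds.
Context {R : realType}.
Implicit Types (U a f : R -> R) (xi al c t x s : R).

(** Beyond some t0, doubling the argument multiplies f by at most 2^p, because
2^al < 2^p.  Iterating this and using monotonicity between two powers of 2
costs one extra factor 2^p. *)
Lemma potter_bound al p M f : (forall s t, M < s -> s <= t -> f s <= f t) ->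
  (forall t, M < t -> 0 < f t) ->
  f (2 * t) / f t @[t --> +oo] --> 2 `^ al -> al < p -> 0 <= p ->
  exists2 t0 : R, M < t0 /\ 0 < t0 & forall t l, t0 <= t -> 1 <= l ->
    f (l * t) <= 2 `^ p * l `^ p * f t.
Proof.
move=> fnd f0 fal alp p0.
have /(cvgr_lt _ fal) [N [_ NP]] : (2:R) `^ al < 2 `^ p.
  by rewrite /powR gt_eqF// ltr_expR ltr_pM2r// ln_gt0//; lra.
pose t0 := `|M| + `|N| + 1.
have t0M : M < t0 by have := ler_norm M; have := normr_ge0 N; rewrite /t0; lra.
have t0N : N < t0 by have := ler_norm N; have := normr_ge0 M; rewrite /t0; lra.
have t00 : 0 < t0 by have := normr_ge0 N; have := normr_ge0 M; rewrite /t0; lra.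
exists t0 => //.
have dbl t : t0 <= t -> f (2 * t) <= 2 `^ p * f t.
  move=> tt; rewrite -ler_pdivrMr ?f0//; last by lra.
  by apply/ltW/NP; lra.
have step k t l : t0 <= t -> 1 <= l -> l <= 2 ^+ k -> f (l * t) <= 2 `^ p * l `^ p * f t.
  move=> tt; elim: k l => [|k IH] l l1 l2.
    have -> : l = 1 by rewrite expr0 in l2; lra.
    rewrite powR1 mul1r mulr1; apply: le_trans (dbl _ tt); apply: fnd; lra.
  have ft : 0 < f t by apply: f0; lra.
  have l1p : 1 <= l `^ p.
    by rewrite -(powRr0 l); apply: ler_powR.
  have [h|h] := leP l 2.
    apply: (@le_trans _ _ (f (2 * t))).
      by apply: fnd; nra.
    by apply: (le_trans (dbl _ tt)); rewrite ler_pM2r// ler_peMr// powR_ge0.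
  have h1 : 1 <= l / 2 by lra.
  have h2 : l / 2 <= 2 ^+ k by rewrite exprS in l2; lra.
  have := dbl (l / 2 * t); rewrite mulrA (_ : 2 * (l / 2) = l); last by field.
  have lt0 : t0 <= l / 2 * t by nra.
  move=> /(_ lt0) /le_trans; apply.
  rewrite -[leRHS]mulrA ler_pM2l ?powR_gt0//; apply: (le_trans (IH _ h1 h2)).
  rewrite -powRM//; last by lra.
  by rewrite (_ : 2 * (l / 2) = l)//; field.
move=> t l tt l1; have [k kP] := pow_unbounded 2 l ltac:(lra).
exact: step k _ _ tt l1 kP.
Qed.

(** Monotonicity squeezes f(u_n) between f at n/s and f at dn, for a fixed d > 1/s
so close to 1/s that d^al exceeds s^(-al) by little; the shift by 1 disappears
in the gap between n/s and dn. *)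
Lemma regular_ratio_cvg al M f s (u : nat -> R) :
  (forall s t, M < s -> s <= t -> f s <= f t) ->
  (forall t, M < t -> 0 < f t) ->
  (forall c, 0 < c -> f (c * t) / f t @[t --> +oo] --> c `^ al) ->
  0 < s -> (forall n, n%:R / s <= u n <= n%:R / s + 1) ->
  f (u n) / f n%:R @[n --> \oo] --> s^-1 `^ al.
Proof.
move=> fnd f0 fal s0 us.
have c0 : 0 < s^-1 by rewrite invr_gt0.
have fn c : 0 < c -> f (c * n%:R) / f n%:R @[n --> \oo] --> c `^ al.
  by move=> cc; have := fal c cc => /cvg_pinftyP; apply; exact: cvgr_idn.
apply/cvgrPdist_le => e e0.
have e20 : 0 < e / 2 by lra.
have [d [d0 de]] : exists d : R, s^-1 < d /\ d `^ al <= s^-1 `^ al + e / 2.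
  have /cvgrPdist_le/(_ _ e20)[r /= r0 rP] := cvg_powR al _ c0.
  exists (s^-1 + r / 2); split; first by lra.
  have := rP (s^-1 + r / 2); rewrite /= opprD addNKr normrN gtr0_norm; last by lra.
  move=> /(_ ltac:(lra)); rewrite ler_norml => /andP[+ _]; lra.
have d00 : 0 < d by lra.
near=> n.
have nM : M < n%:R by near: n; apply: nbhs_infty_gtr.
have nMs : M < n%:R / s by rewrite ltr_pdivlMr//; near: n; apply: nbhs_infty_gtr.
have nd : (d - s^-1)^-1 <= n%:R by near: n; apply: nbhs_infty_ger.
have und : u n <= d * n%:R.
  have /andP[_ /le_trans] := us n; apply.
  have : (d - s^-1) * (d - s^-1)^-1 <= (d - s^-1) * n%:R by rewrite ler_pM2l// subr_gt0.
  rewrite mulfV; last by rewrite gt_eqF// subr_gt0.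
  rewrite mulrBl (mulrC s^-1); lra.
have [un1 un2] := andP (us n).
have fn0 := f0 _ nM.
have H1 : s^-1 `^ al - e <= f (s^-1 * n%:R) / f n%:R.
  by near: n; apply: (cvgr_ge _ (fn _ c0)); lra.
have H2 : f (d * n%:R) / f n%:R <= d `^ al + e / 2.
  by near: n; apply: (cvgr_le _ (fn _ d00)); lra.
have H3 : f (s^-1 * n%:R) / f n%:R <= f (u n) / f n%:R.
  by rewrite ler_pM2r ?invr_gt0// (mulrC s^-1); apply: fnd.
have H4 : f (u n) / f n%:R <= f (d * n%:R) / f n%:R.
  by rewrite ler_pM2r ?invr_gt0//; apply: fnd => //; lra.
rewrite ler_norml; apply/andP; split; lra.
Unshelve. all: by end_near. Qed.

(** U/a is the quotient of (U(2t) - U(t))/a(t) by U(2t)/U(t) - 1.  It is applied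
to U itself and to xs - U. *)
Lemma ratio_auxiliary_cvg xi (k : R) U a : (\forall t \near +oo, U t != 0) ->
  (2:R) `^ xi != 1 -> U (2 * t) / U t @[t --> +oo] --> 2 `^ xi ->
  (U (t * 2) - U t) / a t @[t --> +oo] --> k ->
  U t / a t @[t --> +oo] --> k / (2 `^ xi - 1).
Proof.
move=> U0 x1 H1 H2.
have D : U (2 * t) / U t - 1 @[t --> +oo] --> (2:R) `^ xi - 1.
  by apply: cvgB => //; exact: cvg_cst.
have D0 : (2:R) `^ xi - 1 != 0 by rewrite subr_eq0.
have H : (U (t * 2) - U t) / a t / (U (2 * t) / U t - 1) @[t --> +oo] --> k / (2 `^ xi - 1).
  by apply: cvgM => //; exact: cvgV.
apply: (cvg_near_eq _ _ _ H); near=> t.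
have Ut : U t != 0 by near: t.
have Ut1 : U (2 * t) / U t - 1 != 0 by near: t; exact: (cvgr_neq0 _ D).
have Ut2 : U (2 * t) - U t != 0.
  apply: contra Ut1 => /eqP E; rewrite (_ : _ - 1 = (U (2 * t) - U t) / U t).
    by rewrite E mul0r.
  by field.
rewrite (mulrC t); have [->|at0] := eqVneq (a t) 0; first by rewrite invr0 !mulr0 mul0r.
move: Ut2; set u := U (2 * t) => Ut2; field; rewrite at0 Ut mulN1r.
Unshelve. all: by end_near. Qed.

End RegularlyVaryingBounds.

(** * Euler's integral *)

Section GammaIntegrals.
Context {R : realType}.
Local Notation mu := (@lebesgue_measure R).
Implicit Types (al s : R).

Definition gamma_integrand al s : R := s `^ al * expR (- s).

Lemma gamma_integrand_ge0 al s : 0 <= gamma_integrand al s.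
Proof. by rewrite mulr_ge0 ?powR_ge0 ?expR_ge0. Qed.

Lemma measurable_gamma_integrand al (D : set R) : measurable D ->
  measurable_fun D (gamma_integrand al).
Proof.
move=> mD; apply: measurable_funM; last exact: measurable_expRN.
by apply/measurable_funTS; exact: measurable_powR.
Qed.

(** An integer m >= al reduces the claim to s^m exp (- s), and exp s dominates
s^(m+1) / (m+1)!. *)
Lemma gamma_integrand_cvgy al : gamma_integrand al s @[s --> +oo] --> (0 : R).
Proof.
have [m mP] : exists m : nat, al <= m%:R.
  by exists (Num.bound `|al|); rewrite (le_trans (ler_norm al))// ltW// archi_boundP.
apply/cvgrPdist_le => e e0; near=> s.
have s1 : 1 <= s by near: s; apply: nbhs_pinfty_ge; exact: num_real.
have s2 : (m.+1)`!%:R / e <= s by near: s; apply: nbhs_pinfty_ge; exact: num_real.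
have s0 : 0 < s by lra.
rewrite sub0r normrN ger0_norm ?gamma_integrand_ge0// /gamma_integrand.
apply: (@le_trans _ _ (s ^+ m * expR (- s))).
  by rewrite ler_wpM2r ?expR_ge0// -(powR_mulrn m (ltW s0)) ler_powR.
rewrite expRN ler_pdivrMr ?expR_gt0//.
have f0 : (0 : R) < (m.+1)`!%:R by rewrite ltr0n fact_gt0.
apply: (@le_trans _ _ (e * (s ^+ m.+1 / (m.+1)`!%:R))); last first.
  by rewrite ler_pM2l//; have := expR_ge1Dxn m (ltW s0); lra.
rewrite exprS (_ : e * _ = s * e / (m.+1)`!%:R * s ^+ m); last by field; rewrite gt_eqF.
have sm0 : 0 <= s ^+ m by rewrite exprn_ge0// ltW.
by rewrite ler_peMl// ler_pdivlMr// mul1r -ler_pdivrMr.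
Unshelve. all: by end_near. Qed.

Lemma gamma_integrand_cvg0 al : 0 < al ->
  gamma_integrand al s @[s --> 0^'+] --> (0 : R).
Proof.
move=> al0; rewrite -[X in _ --> X](mul0r (expR (- 0))); apply: cvgM.
  exact: powR_cvg0.
by apply: cvg_at_right_filter; exact: continuous_expRN.
Qed.

(** Compact windows exhausting the half-line.  They stay away from 0, where s^al
need not be differentiable, and n.+2 keeps every window nonempty. *)
Definition gamma_window n : set R := `[n.+2%:R^-1, n.+2%:R].

Lemma gamma_window_exhaust : \bigcup_n gamma_window n = `]0, +oo[%classic.
Proof.
apply/seteqP; split => [s [n _]|s]; rewrite /gamma_window /= !in_itv/=.
  by move=> /andP[h _]; rewrite andbT (lt_le_trans _ h)// invr_gt0.
rewrite andbT => s0.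
exists (maxn (Num.bound s) (Num.bound s^-1)) => //.
rewrite /gamma_window/= in_itv/=; apply/andP; split.
  rewrite -[leRHS]invrK lef_pV2 ?posrE ?invr_gt0//.
  rewrite (le_trans (ltW (archi_boundP _)))//; first by rewrite invr_ge0 ltW.
  by rewrite ler_nat; lia.
rewrite (le_trans (ltW (archi_boundP (ltW s0))))//.
by rewrite ler_nat; lia.
Qed.

Lemma gamma_window_nd : {homo gamma_window : n m / (n <= m)%N >-> (n <= m)%O}.
Proof.
move=> n m nm; apply/subsetPset => s; rewrite /gamma_window/= !in_itv/= => /andP[h1 h2].
have nmR : (n.+2%:R : R) <= m.+2%:R by rewrite ler_nat !ltnS.
by rewrite (le_trans _ h1) ?(le_trans h2)// lef_pV2 ?posrE.
Qed.

Lemma gamma_window_cvg al :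
  (\int[mu]_(s in gamma_window n) (gamma_integrand al s)%:E)%E @[n --> \oo] -->
  (\int[mu]_(s in `]0%R, +oo[) (gamma_integrand al s)%:E)%E.
Proof.
rewrite -gamma_window_exhaust; apply: ge0_nondecreasing_set_cvg_integral.
- exact: gamma_window_nd.
- by move=> n; exact: measurable_itv.
- by move=> n; apply/measurable_EFinP; apply: measurable_gamma_integrand; exact: measurable_itv.
- by move=> n s _; rewrite lee_fin gamma_integrand_ge0.
Qed.

Lemma gamma_window_parts al n : 0 < al ->
  (\int[mu]_(s in gamma_window n) (gamma_integrand al s)%:E =
  (gamma_integrand al n.+2%:R^-1 - gamma_integrand al n.+2%:R)%:E +
  al%:E * \int[mu]_(s in gamma_window n) (gamma_integrand (al - 1) s)%:E)%E.
Proof.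
move=> al0; set a : R := n.+2%:R^-1; set b : R := n.+2%:R.
have a0 : 0 < a by rewrite invr_gt0.
have b1 : 1 < b by rewrite /b ltr1n.
have ab : a < b by apply: (@lt_trans _ _ 1) => //; rewrite /a invf_lt1.
have pos s : s \in `]a, b[ -> 0 < s by rewrite in_itv/= => /andP[/(lt_trans a0)].
have dE := @is_derive_expRN R.
have cP (p : R) s : 0 < s -> {for s, continuous (fun s : R => s `^ p)}.
  by move=> s0; exact: cvg_powR.
have cE := @continuous_expRN R.
have pos' s : s \in `[a, b]%classic -> 0 < s.
  by rewrite inE/= in_itv/= => /andP[/(lt_le_trans a0)].
have cp (p : R) : {within `[a, b], continuous (fun s : R => s `^ p)}.
  by apply: continuous_in_subspaceT => s /pos'; exact: cP.
have := @integration_by_parts R (fun s => s `^ al) (fun s => - expR (- s))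
  (fun s => al * s `^ (al - 1)) (fun s => expR (- s)) a b ab.
rewrite -/(gamma_window n) => ->.
- rewrite /gamma_integrand -/a -/b; congr (_ + _)%E; first by congr EFin; ring.
  rewrite -ge0_integralZl//=; last 4 first.
  + exact: measurable_itv.
  + apply/measurable_EFinP; apply: measurable_gamma_integrand; exact: measurable_itv.
  + by move=> s _; rewrite lee_fin gamma_integrand_ge0.
  + by rewrite lee_fin ltW.
  rewrite [X in (- X)%E](_ : _ = \int[mu]_(s in gamma_window n)
      - (al%:E * (gamma_integrand (al - 1) s)%:E))%E; last first.
    by apply: eq_integral => s _; rewrite -EFinM -EFinN; congr EFin; rewrite /gamma_integrand; ring.
  rewrite integral_ge0N ?oppeK// => s _.
  by rewrite mule_ge0// lee_fin ?gamma_integrand_ge0// ltW.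
- apply: continuous_in_subspaceT => s /pos' s0.
  by apply: cvgM; [exact: cvg_cst | exact: cP].
- split.
  + move=> s /pos s0; apply: derivable_powR; by rewrite in_itv/= s0.
  + by apply: cvg_at_right_filter; apply: cP.
  + by apply: cvg_at_left_filter; apply: cP; exact: lt_trans ab.
- by move=> s /pos s0; apply: powR_derive1; rewrite in_itv/= s0.
- by apply: continuous_in_subspaceT => s _; exact: cE.
- split.
  + by move=> s _; exact: ex_derive.
  + by apply: cvg_at_right_filter; apply: cvgN; apply: cE.
  + by apply: cvg_at_left_filter; apply: cvgN; apply: cE.
- by move=> s _; rewrite derive1E; exact: derive_val.
Qed.

(** Integration by parts on the windows, whose boundary terms vanish in the limit.
Stated with extended real values, the identity also transfers finiteness
between the exponents al and al - 1. *)
Lemma gamma_integral_shift al : 0 < al ->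
  (\int[mu]_(s in `]0%R, +oo[) (gamma_integrand al s)%:E =
   al%:E * \int[mu]_(s in `]0%R, +oo[) (gamma_integrand (al - 1) s)%:E)%E.
Proof.
move=> al0.
set J := (\int[mu]_(s in `]0%R, +oo[) (gamma_integrand (al - 1) s)%:E)%E.
suff H : (\int[mu]_(s in gamma_window n) (gamma_integrand al s)%:E)%E @[n --> \oo] -->
    (0 + al%:E * J)%E by rewrite -[RHS]add0e; exact: (cvg_unique _ (gamma_window_cvg al) H).
rewrite (eq_cvg _ _ (fun n => gamma_window_parts al n al0)).
have ny : (n.+2%:R : R) @[n --> \oo] --> +oo.
  apply/cvgryPge => A; near=> n; apply: (@le_trans _ _ n%:R); last by rewrite ler_nat; lia.
  near: n; exact: nbhs_infty_ger.
apply: cvgeD => //; last by apply: cvgeZl => //; exact: gamma_window_cvg.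
apply: cvg_EFin; first exact: nearW.
rewrite -[X in _ --> X](subr0 0); apply: cvgB.
  have /cvg_at_rightP := gamma_integrand_cvg0 al al0; apply; split => //.
  by have := @cvg_harmonic R; rewrite -cvg_shiftS.
by have /cvg_pinftyP := gamma_integrand_cvgy al; apply.
Unshelve. all: by end_near. Qed.

End GammaIntegrals.

Section GammaDominated.
Context {R : realType}.
Local Notation mu := (@lebesgue_measure R).
Implicit Types (al s : R).

Lemma gamma_integral0 :
  (\int[mu]_(s in `]0%R, +oo[) (gamma_integrand 0 s)%:E = 1)%E.
Proof.
have cE := @continuous_expRN R.
have dE := @is_derive_expRN R.
rewrite (_ : \int[mu]_(s in _) _ = \int[mu]_(s in `]0%R, +oo[) (expR (- s))%:E)%E; last first.
  by apply: eq_integral => s _; rewrite /gamma_integrand powRr0 mul1r.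
rewrite integral_itv_obnd_cbnd; last first.
  by apply/measurable_EFinP; exact: measurable_expRN.
rewrite (@ge0_continuous_FTC2y _ (fun s => expR (- s)) (fun s => - expR (- s)) 0 0).
- by rewrite oppr0 expR0 EFinN oppeK add0e.
- by move=> s _; exact: expR_ge0.
- by apply: continuous_subspaceT; exact: cE.
- by rewrite -oppr0; apply: cvgN; exact: cvgr_expR.
- by move=> s _; exact: ex_derive.
- by apply: cvg_at_right_filter; apply: cvgN; exact: cE.
- by move=> s _; rewrite derive1E; exact: derive_val.
Qed.

(** Finiteness is known for the exponent 0, climbs through the naturals by the
functional equation, extends to nonnegative exponents by s^p <= 1 + s^m, and
the functional equation read backwards reaches the exponents in ]-1, 0[,
whose integrand is unbounded at 0. *)
Lemma integrable_gamma_integrand al : -1 < al ->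
  mu.-integrable `]0, +oo[ (EFin \o gamma_integrand al).
Proof.
move=> al1; apply/integrableP; split.
  by apply/measurable_EFinP; apply: measurable_gamma_integrand; exact: measurable_itv.
under eq_integral do rewrite /= ger0_norm ?gamma_integrand_ge0//.
have nat_fin (m : nat) : (\int[mu]_(s in `]0%R, +oo[) (gamma_integrand m%:R s)%:E < +oo)%E.
  elim: m => [|m IH]; first by rewrite gamma_integral0 ltry.
  rewrite gamma_integral_shift ?ltr0n// -natr1 addrK.
  by rewrite lte_mul_pinfty// lee_fin.
have pos_fin p : 0 <= p -> (\int[mu]_(s in `]0%R, +oo[) (gamma_integrand p s)%:E < +oo)%E.
  move=> p0; pose m := Num.bound p.
  have pm : p <= m%:R by rewrite ltW// archi_boundP.
  have M (q : R) : measurable_fun (`]0, +oo[%classic : set R) (EFin \o gamma_integrand q).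
    by apply/measurable_EFinP; apply: measurable_gamma_integrand; exact: measurable_itv.
  apply: (@le_lt_trans _ _ (\int[mu]_(s in `]0%R, +oo[)
      ((gamma_integrand 0 s)%:E + (gamma_integrand m%:R s)%:E))%E).
    apply: ge0_le_integral => //.
    + by move=> s _; rewrite lee_fin gamma_integrand_ge0.
    + exact: M.
    + by apply: emeasurable_funD; exact: M.
    + move=> s /=; rewrite in_itv/= andbT => s0; rewrite lee_fin -mulrDl.
      rewrite ler_wpM2r ?expR_ge0// powRr0.
      have [s1|s1] := leP 1 s.
        by rewrite (le_trans (ler_powR s1 pm))// lerDr.
      have : s `^ p <= s `^ 0 by apply: ger_powR => //; rewrite s0 ltW.
      by rewrite powRr0 => /le_trans; apply; rewrite lerDl powR_ge0.
  rewrite ge0_integralD//=; last 4 first.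
  + by move=> s _; rewrite lee_fin gamma_integrand_ge0.
  + exact: M.
  + by move=> s _; rewrite lee_fin gamma_integrand_ge0.
  + exact: M.
  by rewrite gamma_integral0 lte_add_pinfty ?ltry.
have [/pos_fin//|al0] := leP 0 al.
have al2 : 0 < al + 1 by lra.
have := pos_fin _ (ltW al2); rewrite gamma_integral_shift// addrK => H.
rewrite ltey; apply: contraTneq H => ->.
by rewrite gt0_muley ?lte_fin// ltxx.
Qed.

Lemma gamma_integralE al : -1 < al ->
  (\int[mu]_(s in `]0%R, +oo[) (gamma_integrand al s)%:E = (gamma_integral (al + 1))%:E)%E.
Proof.
move=> al1; rewrite /gamma_integral /Rintegral fineK.
  by apply: eq_integral => s _; rewrite addrK.
rewrite addrK; apply: integrable_fin_num => //.
exact: integrable_gamma_integrand.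
Qed.

Lemma gamma_integral_recl al : 0 < al -> gamma_integral (al + 1) = al * gamma_integral al.
Proof.
move=> al0; apply: EFin_inj; rewrite -gamma_integralE; last by lra.
rewrite gamma_integral_shift// gamma_integralE; last by lra.
by rewrite subrK EFinM.
Qed.

Lemma gamma_integral_1 : @gamma_integral R 1 = 1.
Proof.
apply: EFin_inj; rewrite -[X in gamma_integral X]add0r -gamma_integralE; last by lra.
exact: gamma_integral0.
Qed.

Lemma Gamma_gt0E (s : R) : 0 < s -> Gamma s = gamma_integral s.
Proof. by move=> s0; rewrite /Gamma s0 addr0 big_ord0 divr1. Qed.

Lemma Gamma_oppE (xi : R) : 0 < xi -> xi < 1 ->
  Gamma (- xi) = - (gamma_integral (1 - xi) / xi).
Proof.
move=> xi0 xi1; rewrite /Gamma ltNge oppr_le0 (ltW xi0)/= opprK.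
have -> : Num.truncn xi = 0%N.
  by apply/eqP; rewrite -leqn0 -ltnS truncn_lt_nat ?ltW.
by rewrite big_ord1 addr0 invrN mulrN addrC.
Qed.

(** Two exponents are allowed in the dominating function because the bound near 0
and the bound near infinity have different origins. *)
Lemma gamma_dominated_cvg al be p C (h : nat -> R -> R) :
  -1 < al -> -1 < be -> -1 < p ->
  (forall n, measurable_fun (`]0, +oo[%classic : set R) (h n)) ->
  (forall s, 0 < s -> h n s @[n --> \oo] --> s `^ al) ->
  (\forall n \near \oo, forall s, 0 < s -> `|h n s| <= C * (s `^ be + s `^ p)) ->
  (\int[mu]_(s in `]0%R, +oo[) (h n s * expR (- s))%:E)%E @[n --> \oo] -->
  (gamma_integral (al + 1))%:E.
Proof.
move=> al1 be1 p1 mh hcvg [N _ hb].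
rewrite -gamma_integralE// -(cvg_shiftn N).
apply: (@dominated_cvg _ _ _ mu _ _
  (fun n s => (h (n + N)%N s * expR (- s))%:E) (fun s => (gamma_integrand al s)%:E)
  (fun s => (C%:E * ((gamma_integrand be s)%:E + (gamma_integrand p s)%:E))%E)).
- exact: measurable_itv.
- move=> n; apply/measurable_EFinP; apply: measurable_funM; first exact: mh.
  exact: measurable_expRN.
- move=> s; rewrite /= in_itv/= andbT => s0.
  apply: cvg_EFin; first exact: nearW.
  apply: cvgM; last exact: cvg_cst.
  by have := hcvg s s0; rewrite -(cvg_shiftn N).
- by move=> s _; rewrite -EFinD -EFinM.
- apply: integrableZl; first exact: measurable_itv.
  by apply: integrableD; [exact: measurable_itv|exact: integrable_gamma_integrand..].
- move=> n s; rewrite /= in_itv/= andbT => s0.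
  rewrite -?EFinD -EFinM lee_fin normrM (ger0_norm (expR_ge0 _)).
  by rewrite -mulrDl mulrA ler_wpM2r ?expR_ge0//; apply: hb => //=; exact: leq_addl.
Qed.

End GammaDominated.

(** * The tail quantile function *)

Section TailQuantile.
Context {R : realType}.
Implicit Types (F : R -> R) (s t x y p : R).

Record nonneg_cdf F : Prop := NonnegCdf {
  ncdf_nd : forall x y, x <= y -> F x <= F y;
  ncdf_ge0 : forall x, 0 <= F x;
  ncdf_le1 : forall x, F x <= 1;
  ncdf_neg : forall x, x < 0 -> F x = 0;
  ncdf_y : F x @[x --> +oo] --> (1 : R);
  ncdf_right : forall x, F y @[y --> x^'+] --> F x }.

Variable F : R -> R.
Hypothesis HF : nonneg_cdf F.
Local Notation U := (tail_quantile F).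

Lemma tail_quantile_setE t : 0 < t ->
  [set x : R | (t%:E <= (1 - F x)%:E^-1)%E] = [set x | 1 - t^-1 <= F x].
Proof.
move=> t0; apply/seteqP.
have E x : (t%:E <= (1 - F x)%:E^-1)%E = (1 - t^-1 <= F x).
  have := ncdf_le1 _ HF x; rewrite -subr_ge0 => Fx.
  rewrite [RHS](_ : _ = (1 - F x <= t^-1)); last by apply/idP/idP; lra.
  rewrite inver; case: eqVneq => [->|Fn0]; first by rewrite leey invr_ge0 ltW.
  have F0 : 0 < 1 - F x by rewrite lt_neqAle eq_sym Fn0.
  by rewrite lee_fin -[t in LHS]invrK lef_pV2 ?posrE// invr_gt0.
by split=> x /=; rewrite E.
Qed.

(** The Galois connection between U and F; right continuity of F puts the infimum
defining U(t) in its own set. *)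
Lemma tail_quantile_le t y : 1 < t -> (U t <= y) = (1 - t^-1 <= F y).
Proof.
move=> t1; have t0 : 0 < t by lra.
rewrite /tail_quantile tail_quantile_setE//.
set S := [set x | _].
have p1 : 1 - t^-1 < 1 by rewrite ltrBlDr ltrDl invr_gt0.
have p0 : 0 < 1 - t^-1 by rewrite subr_gt0 invf_lt1.
have Slb : lbound S 0.
  move=> x Sx; rewrite leNgt; apply/negP => x0; move: Sx.
  by rewrite /S /= (ncdf_neg _ HF)// leNgt p0.
have S0 : S !=set0.
  have [M [_ MP]] := cvgr_ge _ (ncdf_y _ HF) _ p1.
  by exists (M + 1); apply: MP; lra.
have Sinf : has_inf S by split => //; exists 0.
apply/idP/idP => [iy|Sy]; last by apply: ge_inf => //; exists 0.
apply: le_trans (ncdf_nd _ HF _ _ iy).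
apply: (cvgr_to_ge (ncdf_right _ HF (inf S))).
near=> z.
have iz : inf S < z by near: z; exact: nbhs_right_gt.
have [w Sw wz] := inf_lt S0 iz.
by rewrite (le_trans Sw)//; apply: (ncdf_nd _ HF); exact: ltW.
Unshelve. all: by end_near. Qed.

Lemma tail_quantile_ge0 t : 1 < t -> 0 <= U t.
Proof.
move=> t1; rewrite leNgt; apply/negP => Ut0.
have := tail_quantile_le t (U t) t1; rewrite lexx (ncdf_neg _ HF)// => /esym.
by rewrite subr_le0 invf_ge1; lra.
Qed.

Lemma tail_quantile_nd : nondecreasing_gt1 U.
Proof.
move=> s t s1 st; rewrite tail_quantile_le//.
have := tail_quantile_le t (U t) (lt_le_trans s1 st); rewrite lexx => /esym; apply: le_trans.
rewrite lerD2l lerN2 lef_pV2 ?posrE//; lra.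
Qed.

Lemma tail_quantile_near_gt x : (x%:E < right_endpoint F)%E ->
  \forall t \near +oo, x < U t.
Proof.
move=> /ereal_sup_gt[_ [y [y0 Fy] <-]]; rewrite lte_fin => xy.
near=> t.
have t1 : 1 < t by near: t; apply: nbhs_pinfty_gt; exact: num_real.
have tF : (1 - F y)^-1 < t by near: t; apply: nbhs_pinfty_gt; exact: num_real.
rewrite (lt_trans xy)// ltNge tail_quantile_le// -ltNge.
rewrite ltrBrDr addrC -ltrBrDr -[ltRHS]invrK ltf_pV2 ?posrE ?invr_gt0//; lra.
Unshelve. all: by end_near. Qed.

Lemma tail_quantile_cvgy : right_endpoint F = +oo%E -> U t @[t --> +oo] --> +oo.
Proof.
move=> Fy; apply/cvgryPgt => x; apply: tail_quantile_near_gt.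
by rewrite Fy ltry.
Qed.

Lemma tail_quantile_le_endpoint t : (0 < right_endpoint F)%E ->
  (right_endpoint F < +oo)%E -> 1 < t -> U t <= fine (right_endpoint F).
Proof.
move=> F0 Fy t1; apply/ler_addgt0Pr => e e0.
have ff : right_endpoint F \is a fin_num by rewrite ge0_fin_numE// ltW.
have f0 : 0 < fine (right_endpoint F) by rewrite fine_gt0// F0 Fy.
rewrite tail_quantile_le//; set x := _ + e.
have -> : F x = 1.
  apply/eqP; rewrite eq_le (ncdf_le1 _ HF) leNgt; apply/negP => Fx.
  have : (x%:E <= right_endpoint F)%E.
    by apply: ereal_sup_ubound; exists x => //; split=> //; rewrite /x; lra.
  by rewrite -[leRHS]fineK// lee_fin /x; lra.
by rewrite lerBlDr lerDl invr_ge0; lra.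
Qed.

Lemma tail_quantile_cvg : (0 < right_endpoint F)%E ->
  (right_endpoint F < +oo)%E -> U t @[t --> +oo] --> fine (right_endpoint F).
Proof.
move=> F0 Fy; have ff : right_endpoint F \is a fin_num by rewrite ge0_fin_numE// ltW.
apply/cvgrPdist_lt => e e0; near=> t.
have t1 : 1 < t by near: t; apply: nbhs_pinfty_gt; exact: num_real.
have := tail_quantile_le_endpoint t F0 Fy t1.
have : fine (right_endpoint F) - e < U t.
  near: t; apply: tail_quantile_near_gt.
  by rewrite -[ltRHS]fineK// lte_fin; lra.
by move=> h1 h2; rewrite ger0_norm; lra.
Unshelve. all: by end_near. Qed.

(** 1 / (1 - F) evaluated at the level where F^n equals exp (- s); composed with
U it turns an exponential variable into a copy of the maximum of n draws. *)
Definition return_period (n : nat) (s : R) : R := (1 - expR (- (s / n%:R)))^-1.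

(** The case n = 0 holds as well, through 0^-1 = 0; this keeps the bound uniform in
n for [regular_ratio_cvg]. *)
Lemma return_period_bounds n s : 0 < s -> n%:R / s <= return_period n s <= n%:R / s + 1.
Proof.
move=> s0; rewrite /return_period; case: n => [|n].
  by rewrite invr0 mulr0 oppr0 expR0 subrr invr0 mul0r add0r lexx ler01.
have n0 : 0 < n.+1%:R :> R by [].
have <- : (s / n.+1%:R)^-1 = n.+1%:R / s by rewrite invf_div.
set u := s / n.+1%:R; have u0 : 0 < u by rewrite divr_gt0.
have E0 : 0 < 1 - expR (- u) by rewrite subr_gt0 -expR0 ltr_expR oppr_lt0.
rewrite lef_pV2 ?posrE//; apply/andP; split.
  by have := expR_ge1Dx (- u); lra.
have -> : u^-1 + 1 = ((u / (1 + u)))^-1 by field; apply/andP; split; lra.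
rewrite lef_pV2 ?posrE ?divr_gt0//; last by lra.
have : expR (- u) <= (1 + u)^-1.
  rewrite expRN lef_pV2 ?posrE ?expR_gt0//; last by lra.
  exact: expR_ge1Dx.
rewrite (_ : u / (1 + u) = 1 - (1 + u)^-1); first by lra.
by field; lra.
Qed.

Lemma return_period_gt1 n s : (0 < n)%N -> 0 < s -> 1 < return_period n s.
Proof.
move=> n0 s0; rewrite /return_period invf_gt1; first by rewrite ltrBlDr ltrDl expR_gt0.
by rewrite subr_gt0 expR_lt1 oppr_lt0 divr_gt0 ?ltr0n.
Qed.

Lemma tail_quantile_gt_return_period n s y : (0 < n)%N -> 0 < s ->
  (y < U (return_period n s)) = (F y < expR (- (s / n%:R))).
Proof.
move=> n0 s0; rewrite !ltNge tail_quantile_le ?return_period_gt1//.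
by rewrite /return_period invrK opprB addrC subrK.
Qed.

End TailQuantile.

(** * Layer cake formula and the exponential coupling *)

Section LayerCake.
Context d (T : measurableType d) (R : realType).
Variable m : {sigma_finite_measure set T -> \bar R}.
Local Notation mu := (@lebesgue_measure R).

(** Tonelli's theorem for the subgraph of Y.  It is used twice: under the
probability with weight 1, and under Lebesgue measure with weight exp (- s).
Comparing the two right-hand sides reduces equality of means to equality of
tails. *)
Lemma weighted_layer_cake (Y w : T -> R) :
  measurable_fun setT Y -> measurable_fun setT w ->
  (forall x, 0 <= Y x) -> (forall x, 0 <= w x) ->
  (\int[m]_x (Y x * w x)%:E =
   \int[mu]_(r in `[0%R, +oo[) \int[m]_(x in [set x | (r < Y x)%R]) (w x)%:E)%E.
Proof.
move=> mY mw Y0 w0.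
pose f (z : T * measurableTypeR R) : \bar R :=
  (if (0 <= z.2) && (z.2 < Y z.1) then w z.1 else 0)%:E.
have mf : measurable_fun setT f.
  apply/measurable_EFinP; apply: measurable_fun_ifT => //.
    apply: measurable_and.
      by apply: measurable_fun_ler => //; exact: measurable_snd.
    apply: measurable_fun_ltr; first exact: measurable_snd.
    by apply: measurableT_comp => //; exact: measurable_fst.
  by apply: measurableT_comp => //; exact: measurable_fst.
have f0 z : (0 <= f z)%E by rewrite /f lee_fin; case: ifP.
transitivity (\int[m]_x \int[mu]_r f (x, r))%E.
  apply: eq_integral => x _.
  transitivity (\int[mu]_r ((w x)%:E * (\1_(`[0%R, Y x[%classic : set R) r)%:E))%E; last first.
    apply: eq_integral => r _; rewrite /f /= indicE mem_setE in_itv/= -EFinM.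
    by case: ifP; rewrite ?mulr1 ?mulr0.
  rewrite ge0_integralZl//; last 2 first.
  - by apply/measurable_EFinP; apply: measurable_indic; exact: measurable_itv.
  - by rewrite lee_fin.
  have E : mu `[0, Y x[%classic = (Y x)%:E.
    rewrite lebesgue_measure_itv/= lte_fin.
    by have := Y0 x; rewrite le_eqVlt => /predU1P[<-|->]; rewrite ?ltxx ?sube0.
  by rewrite integral_indic// setIT [X in (_ * X)%E]E -EFinM mulrC.
rewrite fubini_tonelli// [RHS]integral_mkcond; apply: eq_integral => r _.
rewrite patchE mem_setE in_itv/= andbT.
case: ifPn => r0; last first.
  by apply: integral0_eq => x _; rewrite /f/= (negbTE r0).
rewrite [RHS]integral_mkcond; apply: eq_integral => x _.
rewrite /f/= r0/= patchE; case: ifPn => rY.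
  by rewrite mem_set.
by rewrite memNset//; exact/negP.
Qed.

End LayerCake.

Section ExponentialQuantile.
Context {R : realType}.
Local Notation mu := (@lebesgue_measure R).

Lemma integral_expRN_itv (c : R) : 0 <= c ->
  (\int[mu]_(s in `]0%R, c[) (expR (- s))%:E = (1 - expR (- c))%:E)%E.
Proof.
rewrite le_eqVlt => /predU1P[<-|c0].
  by rewrite set_itv_ge ?bnd_simp ?ltxx// integral_set0 oppr0 expR0 subrr.
have cE := @continuous_expRN R.
have dE := @is_derive_expRN R.
rewrite -(@integral_itv_bndoo _ 0 c _ true false); last first.
  by apply/measurable_EFinP; exact: measurable_expRN.
rewrite (@continuous_FTC2 _ (fun s => expR (- s)) (fun s => - expR (- s)) 0 c)//.
- by rewrite -EFinB oppr0 expR0 opprK addrC.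
- by apply: continuous_subspaceT; exact: cE.
- split.
  + by move=> s _; exact: ex_derive.
  + by apply: cvg_at_right_filter; apply: cvgN; exact: cE.
  + by apply: cvg_at_left_filter; apply: cvgN; exact: cE.
- by move=> s _; rewrite derive1E; exact: derive_val.
Qed.

Variable F : R -> R.
Hypothesis HF : nonneg_cdf F.
Local Notation U := (tail_quantile F).

Lemma measurable_tail_quantile : measurable_fun (`]1, +oo[%classic : set R) U.
Proof.
pose V (t : R) := if 1 < t then U t else 0.
apply: (eq_measurable_fun V).
  by move=> t; rewrite inE/= in_itv/= andbT /V => ->.
apply: nondecreasing_measurable; first exact: measurable_itv.
move=> s t st; rewrite /V; case: ifPn => s1.
  by rewrite (lt_le_trans s1 st); exact: (tail_quantile_nd _ HF).
by case: ifPn => // t1; exact: tail_quantile_ge0.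
Qed.

(** Inversion is written as the power -1, a measurable function; the two agree
where the base is nonnegative. *)
Lemma measurable_return_period n :
  measurable_fun (`]0, +oo[%classic : set R) (return_period n : R -> R).
Proof.
apply: (eq_measurable_fun (fun s : R => (1 - expR (- (s / n%:R))) `^ (- 1))).
  move=> s; rewrite inE/= in_itv/= andbT => s0; rewrite powR_inv1// subr_ge0.
  by rewrite expR_le1 oppr_le0 divr_ge0// ltW.
apply/measurable_funTS; apply: (measurableT_comp (f := fun y : R => y `^ (- 1))).
  exact: measurable_powR.
apply: measurable_funB => //; apply: measurableT_comp => //.
by apply: measurableT_comp => //; exact: measurable_funM.
Qed.

Definition coupled_max (n : nat) (s : R) : R := U (return_period n s).

Lemma measurable_coupled_max n :
  measurable_fun (`]0, +oo[%classic : set R) (coupled_max n).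
Proof.
case: n => [|n].
  apply: (eq_measurable_fun (fun=> U 0)) => // s _.
  by rewrite /coupled_max /return_period invr0 mulr0 oppr0 expR0 subrr invr0.
apply: (measurable_comp (F := (`]1, +oo[%classic : set R))).
- exact: measurable_itv.
- move=> _ [s /= + <-]; rewrite !in_itv/= !andbT; exact: return_period_gt1.
- exact: measurable_tail_quantile.
- exact: measurable_return_period.
Qed.

(** The event y < U(1/(1 - exp (- s/n))) is s < - n ln F(y), an interval whose
exponential mass is 1 - F(y)^n.  When F(y) = 0 it is the whole half-line. *)
Lemma coupled_max_tail n (y : R) : (0 < n)%N ->
  (\int[mu]_(s in [set s : R | (0 < s)%R && (y < coupled_max n s)%R]) (expR (- s))%:E =
   (1 - F y ^+ n)%:E)%E.
Proof.
move=> n0; have nR : 0 < n%:R :> R by rewrite ltr0n.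
have [Fy|Fy] := eqVneq (F y) 0.
  rewrite Fy expr0n gtn_eqF// subr0 -gamma_integral0.
  rewrite (_ : [set s | _] = `]0, +oo[%classic).
    by apply: eq_integral => s _; rewrite /gamma_integrand powRr0 mul1r.
  apply/seteqP; split=> s /=; rewrite in_itv/= andbT; first by case/andP.
  by move=> s0; rewrite s0 tail_quantile_gt_return_period// Fy expR_gt0.
have F0 : 0 < F y by rewrite lt_neqAle eq_sym Fy (ncdf_ge0 _ HF).
rewrite (_ : [set s | _] = `]0, n%:R * - ln (F y)[%classic).
  rewrite integral_expRN_itv; last first.
    by rewrite mulr_ge0// oppr_ge0 ln_le0// (ncdf_le1 _ HF).
  by rewrite mulrN opprK expRM_natl lnK.
apply/seteqP; split=> s /=; rewrite in_itv/=.
  move=> /andP[s0]; rewrite s0 tail_quantile_gt_return_period//= => h.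
  rewrite mulrC -ltr_pdivrMr// ltrNr -ltr_expR lnK//.
move=> /andP[s0 h]; rewrite s0 tail_quantile_gt_return_period//=.
by rewrite -(lnK F0) ltr_expR ltrNr ltr_pdivrMr// mulrC.
Qed.

End ExponentialQuantile.

(** * The law of the maximum *)

Section RunningMax.
Context {R : realType} d (T : measurableType d) (P : probability T R).
Variables (X : nat -> {RV P >-> R}) (F : R -> R).
Local Notation mu := (@lebesgue_measure R).
Hypothesis X_indep : independent_seq X.
Hypothesis X_ident : identically_distributed X.
Hypothesis X_ge0 : forall i, {ae P, forall w, 0 <= X i w}.
Hypothesis X_cdf : forall x, cdf (X 0%N) x = (F x)%:E.

Lemma nonneg_cdf_RV : nonneg_cdf F.
Proof.
split.
- by move=> x y xy; rewrite -lee_fin -!X_cdf; exact: cdf_nondecreasing.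
- by move=> x; rewrite -lee_fin -X_cdf; exact: cdf_ge0.
- by move=> x; rewrite -lee_fin -X_cdf; exact: cdf_le1.
- move=> x x0; apply: EFin_inj; rewrite -X_cdf.
  have [N [mN PN XN]] := X_ge0 0%N.
  apply/eqP; rewrite eq_le; apply/andP; split; last exact: cdf_ge0.
  suff : (P (X 0%N @^-1` `]-oo, x]) <= P N)%E by rewrite PN.
  apply: le_measure; rewrite ?inE//.
    by rewrite -[X in measurable X]setTI; exact: measurable_funP.
  move=> w; rewrite /= in_itv/= => Xw; apply: XN => /= /(le_trans) /(_ Xw).
  by rewrite leNgt x0.
- have := cvg_cdfy1 (X 0%N); rewrite (eq_cvg _ _ X_cdf) => /fine_cvgP[_].
  by [].
- move=> x; have := @cdf_right_continuous _ _ _ _ (X 0%N) x.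
  by rewrite X_cdf (eq_cvg _ _ X_cdf) => /fine_cvgP[_].
Qed.

Lemma bigmax_seq_le (I : Type) (r : seq I) (f : I -> R) (x0 v : R) :
  (\big[Num.max/x0]_(i <- r) f i <= v) = (x0 <= v) && all (fun i => f i <= v) r.
Proof.
elim: r => [|i r IH]; first by rewrite big_nil andbT.
by rewrite big_cons ge_max IH /= andbCA.
Qed.

Lemma running_max_le n w v : (0 < n)%N ->
  (running_max X n w <= v) = all (fun i => X i w <= v) (index_iota 1 n.+1).
Proof.
move=> n0; rewrite /running_max bigmax_seq_le.
apply/idP/idP => [/andP[]//|h]; rewrite h andbT.
by move/allP : h; apply; rewrite mem_index_iota.
Qed.

Lemma measurable_running_max n : measurable_fun setT (running_max X n).
Proof.
rewrite /running_max; elim: (index_iota 1 n.+1) => [|i r IH].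
  by under eq_fun do rewrite big_nil; exact: measurable_funP.
by under eq_fun do rewrite big_cons; apply: measurable_maxr => //; exact: measurable_funP.
Qed.

Lemma big_mule_const (I : Type) (r : seq I) (p : R) :
  (\big[*%E/1%E]_(i <- r) p%:E = (p ^+ size r)%:E)%E.
Proof.
elim: r => [|i r IH]; first by rewrite big_nil expr0.
by rewrite big_cons IH /= exprS EFinM.
Qed.

Lemma running_max_cdf n v : (0 < n)%N ->
  P [set w | running_max X n w <= v] = (F v ^+ n)%:E.
Proof.
move=> n0; pose J := [fset i in index_iota 1 n.+1]%fset.
have := X_indep J (fun=> `]-oo, v]%classic) (fun i _ => measurable_itv _).
rewrite (eq_bigr (fun=> (F v)%:E)); last first.
  by move=> i _; rewrite -X_cdf; exact: (X_ident i 0%N _ (measurable_itv _)).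
rewrite big_mule_const.
have -> : size J = n.
  rewrite -[size J]/(#|` J|) card_fseq undup_id ?iota_uniq//.
  by rewrite size_iota subn1.
move=> <-; congr (P _); apply/seteqP; split => w /=.
  rewrite running_max_le// => /allP H i /=; rewrite in_itv/=.
  by rewrite !inE => /H.
move=> H; rewrite running_max_le//; apply/allP => i ir.
by have := H i; rewrite /= in_itv/= !inE; apply.
Qed.

Lemma overshoot_ge0 n x w : 0 < x -> 0 <= overshoot X n x w.
Proof. by move=> x0; rewrite divr_ge0 ?(ltW x0)// le_max lexx orbT. Qed.

Lemma measurable_overshoot n x : measurable_fun setT (overshoot X n x).
Proof.
apply: measurable_funM => //; apply: measurable_maxr => //.
by apply: measurable_funB => //; exact: measurable_running_max.
Qed.

Definition coupled_overshoot n x (s : R) : R :=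
  Num.max (coupled_max F n s - x) 0 / x.

Lemma measurable_coupled_overshoot n x :
  measurable_fun (`]0, +oo[%classic : set R) (coupled_overshoot n x).
Proof.
apply: measurable_funM => //; apply: measurable_maxr => //.
apply: measurable_funB => //; exact: measurable_coupled_max nonneg_cdf_RV _.
Qed.

Lemma overshoot_gt (y z r : R) : 0 < y -> 0 <= r ->
  (r < Num.max (z - y) 0 / y) = (y + r * y < z).
Proof.
move=> y0 r0; rewrite ltr_pdivlMr// lt_max.
have ry : 0 <= r * y by rewrite mulr_ge0// ltW.
by rewrite orbC ltNge ry/= ltrBrDl.
Qed.

(** The coupling formula: both sides are integrals over r of the same tail
1 - F(x + rx)^n. *)
Lemma expectation_overshoot n x : (0 < n)%N -> 0 < x ->
  ('E_P[overshoot X n x] =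
  \int[mu]_(s in `]0%R, +oo[) (coupled_overshoot n x s * expR (- s))%:E)%E.
Proof.
move=> n0 x0.
pose Q (s : R) := if 0 < s then coupled_overshoot n x s else 0.
have Q0 s : 0 <= Q s.
  by rewrite /Q; case: ifP => // _; rewrite divr_ge0 ?(ltW x0)// le_max lexx orbT.
have mQ : measurable_fun setT Q.
  have -> : Q = (coupled_overshoot n x) \_ (`]0, +oo[%classic : set R).
    by apply/funext => s; rewrite /Q patchE mem_setE in_itv/= andbT.
  apply/(measurable_restrictT _ (measurable_itv _)).
  exact: measurable_coupled_overshoot.
transitivity (\int[mu]_s (Q s * expR (- s))%:E)%E; last first.
  rewrite [RHS]integral_mkcond; apply: eq_integral => s _.
  by rewrite patchE mem_setE in_itv/= andbT /Q; case: ifP => //; rewrite mul0r.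
rewrite (weighted_layer_cake _ _ _ mu Q (fun s => expR (- s)))//; last first.
  exact: measurable_expRN.
rewrite unlock.
transitivity (\int[P]_w (overshoot X n x w * 1)%:E)%E.
  by apply: eq_integral => w _; rewrite mulr1.
rewrite (weighted_layer_cake _ _ _ P (overshoot X n x) (fun=> 1))//; last 2 first.
- exact: measurable_overshoot.
- by move=> w; exact: overshoot_ge0.
apply: eq_integral => r; rewrite inE/= in_itv/= andbT => r0.
transitivity (1 - F (x + r * x) ^+ n)%:E.
  have -> : [set w | r < overshoot X n x w] = ~` [set w | running_max X n w <= x + r * x].
    by apply/seteqP; split=> w /=; rewrite overshoot_gt// ltNge => /negP.
  have mZ : measurable [set w | running_max X n w <= x + r * x].
    have := measurable_running_max n measurableT `]-oo, x + r * x]%classic (measurable_itv _).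
    by rewrite setTI; congr measurable; apply/seteqP; split => w /=; rewrite in_itv.
  rewrite integral_cst; last exact: measurableC.
  by rewrite mul1e; have := probability_setC P mZ; rewrite running_max_cdf.
rewrite -(coupled_max_tail _ nonneg_cdf_RV)//; congr integral.
apply/seteqP; split=> s /=; rewrite /Q.
  by case/andP => s0; rewrite s0 overshoot_gt.
case: ifPn => s0; first by rewrite overshoot_gt.
by move=> r1; exfalso; move: r0; rewrite leNgt r1.
Qed.

End RunningMax.

(** * Limits of the coupled means *)

Section MeanLimits.
Context {R : realType}.
Local Notation mu := (@lebesgue_measure R).
Variable F : R -> R.
Hypothesis HF : nonneg_cdf F.
Local Notation U := (tail_quantile F).
Local Notation Q := (coupled_max F).
Implicit Types (xi x s : R).

Lemma return_period_ge n s : 0 < s -> n%:R / s <= return_period n s.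
Proof. by move=> s0; have /andP[] := return_period_bounds n s s0. Qed.

Lemma coupled_max_gt x s : (x%:E < right_endpoint F)%E -> 0 < s ->
  \forall n \near \oo, x < Q n s.
Proof.
move=> /(tail_quantile_near_gt F HF)[M [_ MP]] s0; near=> n; apply: MP.
rewrite (lt_le_trans _ (return_period_ge _ _ s0))// ltr_pdivlMr//.
by near: n; exact: nbhs_infty_gtr.
Unshelve. all: by end_near. Qed.

(** Potter's exponent is p = (xi + 1)/2, strictly between xi and 1: s^(-p) is then
integrable at 0.  For s <= 2 the return period is at most 3n/s, with 3/s >= 1
as the Potter bound requires; for s > 2 it is at most n, and monotonicity of U
is enough. *)
Lemma coupled_excess_cvgy xi x : 0 <= xi -> xi < 1 -> 0 < x ->
  right_endpoint F = +oo%E ->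
  (forall c, 0 < c -> U (c * t) / U t @[t --> +oo] --> c `^ xi) ->
  (\int[mu]_(s in `]0%R, +oo[) (Num.max (Q n s - x) 0 / U n%:R * expR (- s))%:E)%E
    @[n --> \oo] --> (gamma_integral (1 - xi))%:E.
Proof.
move=> xi0 xi1 x0 Fy HU.
have Uy := tail_quantile_cvgy F HF Fy.
have [M0 [_ MP]] := tail_quantile_near_gt F HF 0 ltac:(by rewrite Fy ltry).
pose M := `|M0| + 1.
have M1 : 1 <= M by rewrite /M lerDr.
have MM0 : M0 < M by have := ler_norm M0; rewrite /M; lra.
have Und s t : M < s -> s <= t -> U s <= U t.
  by move=> Ms; apply: tail_quantile_nd => //; lra.
have U0 t : M < t -> 0 < U t by move=> Mt; apply: MP; lra.
pose p := (xi + 1) / 2.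
have [t0 [t0M t00] PB] := potter_bound xi p M U Und U0 (HU 2 ltac:(lra))
  ltac:(rewrite /p; lra) ltac:(rewrite /p; lra).
rewrite (_ : 1 - xi = - xi + 1); last by rewrite addrC.
apply: (gamma_dominated_cvg (- xi) (- p) 0 (2 `^ p * 3 `^ p)
  (fun n s => Num.max (Q n s - x) 0 / U n%:R)).
- lra.
- rewrite /p; lra.
- lra.
- move=> n; apply: measurable_funM => //; apply: measurable_maxr => //.
  by apply: measurable_funB => //; exact: measurable_coupled_max.
- move=> s s0.
  have H : (Q n s / U n%:R - x / U n%:R) @[n --> \oo] --> s `^ (- xi).
    rewrite -[s `^ _]subr0; apply: cvgB.
      rewrite -powR_invl//.
      apply: (regular_ratio_cvg xi M U s (fun n => return_period n s)) => //.
      by move=> n; exact: return_period_bounds.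
    rewrite -(mulr0 x); apply: cvgM; first exact: cvg_cst.
    apply/gtr0_cvgV0.
      near=> n; apply: U0; near: n; exact: nbhs_infty_gtr.
    exact: cvg_comp cvgr_idn Uy.
  apply: (cvg_near_eq _ _ _ H).
  near=> n; rewrite -mulrBl; congr (_ / _).
  rewrite max_l// subr_ge0 ltW//; near: n; apply: coupled_max_gt => //.
  by rewrite Fy ltry.
- have p0 : 0 < p by rewrite /p; lra.
  near=> n => s s0.
  have n2 : 2 <= n%:R :> R by near: n; exact: nbhs_infty_ger.
  have nt0 : t0 <= n%:R by near: n; exact: nbhs_infty_ger.
  have nM : M < n%:R by lra.
  have Un := U0 _ nM.
  have n0 : (0 < n)%N by rewrite -(ltr0n R); lra.
  have t1 := return_period_gt1 n s n0 s0.
  have Q0 : 0 <= Q n s by exact: tail_quantile_ge0.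
  rewrite ger0_norm; last by rewrite divr_ge0 ?(ltW Un)// le_max lexx orbT.
  rewrite ler_pdivrMr// powRr0.
  apply: (@le_trans _ _ (Q n s)); first by rewrite ge_max Q0 andbT lerBlDr lerDl ltW.
  have /andP[_ tu] := return_period_bounds n s s0.
  have c0 : 0 <= 2 `^ p * 3 `^ p :> R by rewrite mulr_ge0 ?powR_ge0.
  have c1 : 1 <= 2 `^ p * 3 `^ p :> R.
    have ge1 (b : R) : 1 <= b -> 1 <= b `^ p.
      by move=> b1; have : b `^ 0 <= b `^ p; [exact: ler_powR (ltW p0)|rewrite powRr0].
    by have := ge1 2 ltac:(lra); have := ge1 3 ltac:(lra); nra.
  have sp0 : 0 <= s `^ (- p) by exact: powR_ge0.
  have [s2|s2] := leP s 2.
    apply: (@le_trans _ _ (U (3 / s * n%:R))).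
      apply: tail_quantile_nd => //; apply: (le_trans tu).
      have : 1 <= n%:R / s by rewrite ler_pdivlMr//; lra.
      by rewrite mulrAC -mulrA; lra.
    have l1 : 1 <= 3 / s by rewrite ler_pdivlMr//; lra.
    apply: (le_trans (PB n%:R (3 / s) nt0 l1)).
    rewrite ler_pM2r// powRM ?invr_ge0 ?(ltW s0)//.
    rewrite powR_invl//.
    nra.
  apply: (@le_trans _ _ (U n%:R)).
    apply: tail_quantile_nd => //; apply: (le_trans tu).
    have : n%:R / s <= n%:R / 2 by rewrite ler_pdivrMr//; nra.
    lra.
  by apply: ler_peMl; [exact: ltW | nra].
Unshelve. all: by end_near. Qed.

(** The Potter bound is applied to 1/(xs - U), which is nondecreasing and regularly
varying of index - xi.  It compares n with n/s only if n/s >= t0; for larger s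
the numerator is bounded by xs - x, and the bound between t0 and n shows that
1/(xs - U(n)) grows at most like n^p <= (t0 s)^p. *)
Lemma coupled_deficit_cvg xi xs x : xi <= 0 -> 0 < x -> x < xs ->
  right_endpoint F = xs%:E ->
  (\forall t \near +oo, U t < xs) ->
  (forall c, 1 < c -> (xs - U (c * t)) / (xs - U t) @[t --> +oo] --> c `^ xi) ->
  (\int[mu]_(s in `]0%R, +oo[)
     ((xs - x - Num.max (Q n s - x) 0) / (xs - U n%:R) * expR (- s))%:E)%E
    @[n --> \oo] --> (gamma_integral (1 - xi))%:E.
Proof.
move=> xi0 x0 xxs Fxs [M0 [_ MP]] HL.
have Uxs t : 1 < t -> U t <= xs.
  move=> t1; have := tail_quantile_le_endpoint F HF t.
  by rewrite Fxs; apply => //; rewrite ?ltry// lte_fin; lra.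
pose M := `|M0| + 1.
have M1 : 1 <= M by rewrite /M lerDr.
have MM0 : M0 < M by have := ler_norm M0; rewrite /M; lra.
have L0 t : M < t -> 0 < xs - U t by move=> Mt; rewrite subr_gt0; apply: MP; lra.
pose f t := (xs - U t)^-1.
have f0 t : M < t -> 0 < f t by move=> Mt; rewrite invr_gt0 L0.
have fnd s t : M < s -> s <= t -> f s <= f t.
  move=> Ms st; rewrite lef_pV2 ?posrE ?L0//; last lra.
  by rewrite lerD2l lerN2; apply: tail_quantile_nd => //; lra.
have ff c : 0 < c -> f (c * t) / f t @[t --> +oo] --> c `^ (- xi).
  move=> c0; apply: ratio_cvg_gt0 c0.
    by near=> t; apply: f0; near: t; apply: nbhs_pinfty_gt; exact: num_real.
  move=> {}c c1; rewrite powRN.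
  have c0 : c `^ xi != 0 by rewrite gt_eqF// powR_gt0; lra.
  have H : ((xs - U (c * t)) / (xs - U t))^-1 @[t --> +oo] --> (c `^ xi)^-1.
    by apply: cvgV => //; exact: HL.
  by apply: (cvg_near_eq _ _ _ H); near=> t; rewrite invfM.
pose p := - xi + 1.
have [t0 [t0M t00] PB] := potter_bound (- xi) p M f fnd f0 (ff 2 ltac:(lra))
  ltac:(rewrite /p; lra) ltac:(rewrite /p; lra).
have LB t l : t0 <= t -> 1 <= l -> xs - U t <= 2 `^ p * l `^ p * (xs - U (l * t)).
  move=> tt l1; have := PB t l tt l1.
  have Mt : M < t by lra. have Mlt : M < l * t by nra.
  rewrite /f ler_pdivlMr ?L0// mulrC ler_pdivrMr ?L0//.
pose C := 2 `^ p + 1 + (xs - x) * 2 `^ p / (xs - U t0).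
rewrite (_ : 1 - xi = - xi + 1); last by rewrite addrC.
apply: (gamma_dominated_cvg (- xi) 0 p C
  (fun n s => (xs - x - Num.max (Q n s - x) 0) / (xs - U n%:R))).
- lra.
- lra.
- rewrite /p; lra.
- move=> n; apply: measurable_funM => //; apply: measurable_funB => //.
  apply: measurable_maxr => //.
  by apply: measurable_funB => //; exact: measurable_coupled_max.
- move=> s s0.
  have H : (f (return_period n s) / f n%:R)^-1 @[n --> \oo] --> (s^-1 `^ (- xi))^-1.
    apply: cvgV; first by rewrite gt_eqF// powR_gt0// invr_gt0.
    apply: (regular_ratio_cvg (- xi) M f s (fun n => return_period n s)) => //.
    by move=> n; exact: return_period_bounds.
  rewrite -powRN powR_invl// opprK in H.
  apply: (cvg_near_eq _ _ _ H); near=> n.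
  rewrite max_l; last first.
    rewrite subr_ge0 ltW//; near: n; apply: coupled_max_gt => //.
    by rewrite Fxs lte_fin.
  by rewrite /f invfM invrK invrK /coupled_max; congr (_ * _); lra.
- near=> n => s s0.
  have n1 : 1 <= n%:R :> R by near: n; exact: nbhs_infty_ger.
  have nt0 : t0 <= n%:R by near: n; exact: nbhs_infty_ger.
  have nM : M < n%:R by lra.
  have Ln := L0 _ nM.
  have Lt0 := L0 _ t0M.
  have n0 : (0 < n)%N by rewrite -(ltr0n R); lra.
  have t1 := return_period_gt1 n s n0 s0.
  have Qxs : Q n s <= xs by exact: Uxs.
  have m0 : 0 <= Num.max (Q n s - x) 0 by rewrite le_max lexx orbT.
  have m1 : Q n s - x <= Num.max (Q n s - x) 0 by rewrite le_max lexx.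
  have m2 : Num.max (Q n s - x) 0 <= xs - x by rewrite ge_max; apply/andP; split; lra.
  rewrite ger0_norm; last by rewrite divr_ge0 ?(ltW Ln)// subr_ge0.
  rewrite ler_pdivrMr// powRr0.
  have sp0 : 0 <= s `^ p by exact: powR_ge0.
  have tp0 : 0 <= (2:R) `^ p by exact: powR_ge0.
  have K0 : 0 <= (xs - x) * 2 `^ p / (xs - U t0).
    by rewrite divr_ge0 ?(ltW Lt0)// mulr_ge0//; lra.
  have C1 : 1 <= C by rewrite /C; lra.
  have C2 : 2 `^ p * s `^ p <= C * (1 + s `^ p).
    have : 2 `^ p * s `^ p <= C * s `^ p by rewrite ler_wpM2r// /C; lra.
    lra.
  have C3 : (xs - x) * 2 `^ p / (xs - U t0) * s `^ p <= C * (1 + s `^ p).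
    have : (xs - x) * 2 `^ p / (xs - U t0) * s `^ p <= C * s `^ p by rewrite ler_wpM2r// /C; lra.
    lra.
  have tu := return_period_ge n s s0.
  have [s1|s1] := leP s 1.
    have : U n%:R <= Q n s.
      apply: tail_quantile_nd => //; first lra.
      by apply: le_trans tu; rewrite ler_pdivlMr//; nra.
    move=> UQ; apply: (@le_trans _ _ (xs - U n%:R)); first lra.
    by apply: ler_peMl; [exact: ltW | nra].
  have [ns|ns] := leP t0 (n%:R / s).
    have H1 : U (n%:R / s) <= Q n s by apply: tail_quantile_nd => //; lra.
    have := LB _ _ ns (ltW s1); rewrite (_ : s * (n%:R / s) = n%:R); last by field; lra.
    move=> H2; apply: (@le_trans _ _ (2 `^ p * s `^ p * (xs - U n%:R))); first lra.
    by rewrite ler_pM2r.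
  have l1 : 1 <= n%:R / t0 by rewrite ler_pdivlMr// mul1r.
  have := LB _ _ (lexx t0) l1; rewrite (_ : n%:R / t0 * t0 = n%:R); last by field; lra.
  have H : (n%:R / t0) `^ p <= s `^ p.
    apply: ge0_ler_powR; rewrite ?nnegrE; try (rewrite /p; lra).
    by rewrite ler_pdivrMr// mulrC -ler_pdivrMr// ltW.
  move=> H1; apply: (@le_trans _ _ (xs - x)); first by lra.
  have H2 : xs - U t0 <= 2 `^ p * s `^ p * (xs - U n%:R).
    by apply: (le_trans H1); rewrite ler_pM2r// ler_wpM2l.
  apply: (@le_trans _ _ ((xs - x) * 2 `^ p / (xs - U t0) * s `^ p * (xs - U n%:R))).
    rewrite -!mulrA ler_peMr//; first by lra.
    by rewrite mulrCA mulrC ler_pdivlMr// mul1r mulrA.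
  by rewrite ler_pM2r.
Unshelve. all: by end_near. Qed.

End MeanLimits.

(** * Limits of the means of overshoot and gap *)

Section MeanOvershoot.
Context {R : realType} d (T : measurableType d) (P : probability T R).
Variables (X : nat -> {RV P >-> R}) (F : R -> R).
Local Notation mu := (@lebesgue_measure R).
Hypothesis X_indep : independent_seq X.
Hypothesis X_ident : identically_distributed X.
Hypothesis X_ge0 : forall i, {ae P, forall w, 0 <= X i w}.
Hypothesis X_cdf : forall x, cdf (X 0%N) x = (F x)%:E.
Local Notation U := (tail_quantile F).
Local Notation Q := (coupled_max F).
Local Notation EO := (expectation_overshoot d T P X F X_indep X_ident X_ge0 X_cdf).
Local Notation HF := (nonneg_cdf_RV d T P X F X_ge0 X_cdf).

Lemma rescale_cvg (u b : nat -> R) (E : nat -> \bar R) (k g : R) :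
  (\forall n \near \oo, u n != 0) -> u n / b n @[n --> \oo] --> k ->
  ((u n)^-1%:E * E n)%E @[n --> \oo] --> g%:E ->
  ((b n)^-1%:E * E n)%E @[n --> \oo] --> (k * g)%:E.
Proof.
move=> u0 ub uE.
have H : ((u n / b n)%:E * ((u n)^-1%:E * E n))%E @[n --> \oo] --> (k%:E * g%:E)%E.
  apply: cvgeM => //; apply: cvg_EFin => //; exact: nearW.
rewrite EFinM; apply: (cvg_near_eq _ _ _ H); near=> n.
have un : u n != 0 by near: n.
by rewrite muleA -EFinM mulrAC divff// mul1r.
Unshelve. all: by end_near. Qed.

Lemma mean_overshoot_cvgy xi x : 0 <= xi -> xi < 1 -> 0 < x ->
  right_endpoint F = +oo%E ->
  (forall c, 0 < c -> U (c * t) / U t @[t --> +oo] --> c `^ xi) ->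
  ((U n%:R)^-1%:E * 'E_P[overshoot X n x])%E @[n --> \oo] -->
  (gamma_integral (1 - xi) / x)%:E.
Proof.
move=> xi0 xi1 x0 Fy HU.
have := coupled_excess_cvgy F HF xi x xi0 xi1 x0 Fy HU.
move=> /(cvgeZl (y := x^-1%:E) isT); rewrite -EFinM mulrC => H.
apply: (cvg_near_eq _ _ _ H); near=> n.
have n0 : (0 < n)%N by near: n; exact: nbhs_infty_gt.
have Un : 0 < U n%:R.
  near: n; apply: (near_pinfty_nat (fun t => 0 < U t)); apply: (tail_quantile_near_gt F HF).
  by rewrite Fy ltry.
have mE : measurable_fun (`]0, +oo[%classic : set R) (fun s : R => expR (- s)).
  exact: measurable_expRN.
rewrite EO// -!ge0_integralZl//. all: try exact: measurable_itv.
- apply: eq_integral => s _; rewrite -!EFinM; congr EFin.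
  by rewrite /coupled_overshoot; ring.
- apply/measurable_EFinP; apply: measurable_funM => //.
  exact: (measurable_coupled_overshoot d T P X F X_ge0 X_cdf).
- move=> s _; rewrite lee_fin mulr_ge0 ?expR_ge0//.
  by rewrite divr_ge0 ?(ltW x0)// le_max lexx orbT.
- by rewrite lee_fin invr_ge0 ltW.
- apply/measurable_EFinP; apply: measurable_funM => //; apply: measurable_funM => //.
  apply: measurable_maxr => //; apply: measurable_funB => //.
  exact: (measurable_coupled_max F HF).
- move=> s _; rewrite lee_fin mulr_ge0 ?expR_ge0//.
  by rewrite divr_ge0 ?(ltW Un)// le_max lexx orbT.
- by rewrite lee_fin invr_ge0 ltW.
Unshelve. all: by end_near. Qed.

Variable xs : R.
Hypothesis Fxs : right_endpoint F = xs%:E.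
Hypothesis xs0 : 0 < xs.

Lemma coupled_overshoot_bound n x s : (0 < n)%N -> 0 < x -> x < xs -> 0 < s ->
  0 <= coupled_overshoot F n x s <= (xs - x) / x.
Proof.
move=> n0 x0 xxs s0; rewrite divr_ge0 ?(ltW x0) ?le_max ?lexx ?orbT//=.
rewrite ler_pM2r ?invr_gt0// ge_max; apply/andP; split; last by lra.
rewrite lerB//; have := tail_quantile_le_endpoint F HF (return_period n s).
by rewrite Fxs; apply; rewrite ?ltry ?lte_fin// return_period_gt1.
Qed.

Lemma integrable_coupled_overshoot n x : (0 < n)%N -> 0 < x -> x < xs ->
  mu.-integrable `]0, +oo[ (fun s => (coupled_overshoot F n x s * expR (- s))%:E).
Proof.
move=> n0 x0 xxs.
have mE : measurable_fun (`]0, +oo[%classic : set R) (fun s : R => expR (- s)).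
  exact: measurable_expRN.
apply: (@le_integrable _ _ _ mu _ _ _
  (fun s => ((xs - x) / x)%:E * (gamma_integrand 0 s)%:E)%E).
- exact: measurable_itv.
- apply/measurable_EFinP; apply: measurable_funM => //.
  exact: (measurable_coupled_overshoot d T P X F X_ge0 X_cdf).
- move=> s; rewrite /= in_itv/= andbT => s0.
  have /andP[q0 q1] := coupled_overshoot_bound n x s n0 x0 xxs s0.
  have Kx : 0 <= (xs - x) / x := le_trans q0 q1.
  have E0 := expR_ge0 (- s).
  rewrite lee_fin /gamma_integrand powRr0 mul1r.
  by rewrite (ger0_norm (mulr_ge0 q0 E0)) (ger0_norm (mulr_ge0 Kx E0)) ler_wpM2r.
- apply: integrableZl; first exact: measurable_itv.
  by apply: integrable_gamma_integrand; lra.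
Qed.

(** Subtracting inside the integral is legitimate because the coupled maximum never
exceeds xs, which bounds the overshoot. *)
Lemma mean_overshoot_deficit n x : (0 < n)%N -> 0 < x -> x < xs ->
  (((xs - x) / x)%:E - 'E_P[overshoot X n x] =
   x^-1%:E * \int[mu]_(s in `]0%R, +oo[)
     ((xs - x - Num.max (Q n s - x) 0) * expR (- s))%:E)%E.
Proof.
move=> n0 x0 xxs; rewrite EO//.
have mD : measurable (`]0, +oo[%classic : set (measurableTypeR R)) by exact: measurable_itv.
have I0 : mu.-integrable `]0, +oo[ (fun s => (gamma_integrand 0 s)%:E).
  by apply: integrable_gamma_integrand; lra.
have I1 : mu.-integrable `]0, +oo[ (fun s => ((xs - x) / x)%:E * (gamma_integrand 0 s)%:E)%E.
  exact: integrableZl.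
have I2 := integrable_coupled_overshoot n x n0 x0 xxs.
have -> : ((xs - x) / x)%:E =
    (\int[mu]_(s in `]0%R, +oo[) (((xs - x) / x)%:E * (gamma_integrand 0 s)%:E))%E.
  by rewrite integralZl ?gamma_integral0 ?mule1.
rewrite -integralB// -integralZl//; last first.
  apply: (@eq_integrable _ _ _ mu _ _ (fun s => (x * ((xs - x) / x * gamma_integrand 0 s
      - coupled_overshoot F n x s * expR (- s)))%:E)) => //.
    move=> s _; congr EFin.
    rewrite /gamma_integrand powRr0 /coupled_overshoot; field; exact: lt0r_neq0.
  exact: (integrableZl mD x (integrableB mD I1 I2)).
apply: eq_integral => s _; rewrite -!EFinM -EFinB; congr EFin.
rewrite /gamma_integrand powRr0 /coupled_overshoot; field; exact: lt0r_neq0.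
Qed.

Lemma mean_deficit_cvg xi x : xi <= 0 -> 0 < x -> x < xs ->
  (\forall t \near +oo, U t < xs) ->
  (forall c, 1 < c -> (xs - U (c * t)) / (xs - U t) @[t --> +oo] --> c `^ xi) ->
  ((xs - U n%:R)^-1%:E * (((xs - x) / x)%:E - 'E_P[overshoot X n x]))%E
    @[n --> \oo] --> (gamma_integral (1 - xi) / x)%:E.
Proof.
move=> xi0 x0 xxs Uxs HL.
have := coupled_deficit_cvg F HF xi xs x xi0 x0 xxs Fxs Uxs HL.
move=> /(cvgeZl (y := x^-1%:E) isT); rewrite -EFinM mulrC => H.
apply: (cvg_near_eq _ _ _ H); near=> n.
have n0 : (0 < n)%N by near: n; exact: nbhs_infty_gt.
have Un : 0 < xs - U n%:R.
  by rewrite subr_gt0; near: n; exact: (near_pinfty_nat (fun t => U t < xs)).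
have mE : measurable_fun (`]0, +oo[%classic : set R) (fun s : R => expR (- s)).
  exact: measurable_expRN.
have mnum : measurable_fun (`]0, +oo[%classic : set R)
    (fun s => (xs - x - Num.max (Q n s - x) 0)).
  apply: measurable_funB => //; apply: measurable_maxr => //; apply: measurable_funB => //.
  exact: (measurable_coupled_max F HF).
rewrite mean_overshoot_deficit// muleCA; congr (_ * _)%E.
rewrite -ge0_integralZl//.
- by apply: eq_integral => s _; rewrite -EFinM; congr EFin; ring.
- by apply/measurable_EFinP; apply: measurable_funM.
- move=> s; rewrite /= in_itv/= andbT => s0; rewrite lee_fin mulr_ge0 ?expR_ge0//.
  have /andP[_] := coupled_overshoot_bound n x s n0 x0 xxs s0.
  by rewrite ler_pM2r ?invr_gt0// subr_ge0.
- by rewrite lee_fin invr_ge0 ltW.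
Unshelve. all: by end_near. Qed.

(** Pointwise, xs - max(Z_n, x) = (xs - x) - (Z_n - x)_+, so the gap is an affine
function of the overshoot, and both limits of the bounded case are the same
statement up to the factor x/xs. *)
Lemma expectation_endpoint_gap n x : (0 < n)%N -> 0 < x -> x < xs ->
  ('E_P[endpoint_gap X xs n x] =
   (x / xs)%:E * (((xs - x) / x)%:E - 'E_P[overshoot X n x]))%E.
Proof.
move=> n0 x0 xxs.
have IR : P.-integrable setT (EFin \o overshoot X n x).
  apply/integrableP; split; first by apply/measurable_EFinP; exact: measurable_overshoot.
  rewrite (_ : (\int[P]_w _)%E = 'E_P[overshoot X n x])%E.
    rewrite EO// -ge0_fin_numE.
      apply: integrable_fin_num; [exact: measurable_itv|exact: integrable_coupled_overshoot].
    apply: integral_ge0 => s; rewrite /= in_itv/= andbT => s0.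
    have /andP[q0 _] := coupled_overshoot_bound n x s n0 x0 xxs s0.
    by rewrite lee_fin mulr_ge0 ?expR_ge0.
  rewrite unlock; apply: eq_integral => w _.
  by rewrite /= ger0_norm// overshoot_ge0.
have IC : P.-integrable setT (EFin \o cst ((xs - x) / x)).
  exact: finite_measure_integrable_cst.
transitivity (\int[P]_w ((x / xs)%:E * (((xs - x) / x)%:E - (overshoot X n x w)%:E)))%E.
  rewrite unlock; apply: eq_integral => w _; rewrite -EFinB -EFinM; congr EFin.
  rewrite /endpoint_gap /overshoot.
  have -> : Num.max (running_max X n w) x = Num.max (running_max X n w - x) 0 + x.
    by rewrite addr_maxl subrK add0r.
  by field; rewrite !gt_eqF.
rewrite integralZl//; last by apply: integrableB.
rewrite integralB//; congr (_ * (_ - _))%E; last by rewrite unlock.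
by have := expectation_cst P ((xs - x) / x); rewrite unlock.
Qed.

Lemma mean_endpoint_gap_cvg (b : nat -> R) x (g : R) : 0 < x -> x < xs ->
  ((b n)^-1%:E * (((xs - x) / x)%:E - 'E_P[overshoot X n x]))%E
    @[n --> \oo] --> (g / x)%:E ->
  ((b n)^-1%:E * 'E_P[endpoint_gap X xs n x])%E @[n --> \oo] --> (g / xs)%:E.
Proof.
move=> x0 xxs /(cvgeZl (y := (x / xs)%:E) isT); rewrite -EFinM.
rewrite (_ : x / xs * (g / x) = g / xs) => [H|]; last by field; rewrite !gt_eqF.
apply: (cvg_near_eq _ _ _ H); near=> n.
have n0 : (0 < n)%N by near: n; exact: nbhs_infty_gt.
by rewrite expectation_endpoint_gap// muleCA.
Unshelve. all: by end_near. Qed.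

End MeanOvershoot.

(** * The tail quantile under extended regular variation *)

Section ExtendedRegularVariation.
Context {R : realType}.
Variables (F : R -> R) (xi : R) (a : R -> R).
Hypothesis HF : nonneg_cdf F.
Hypothesis a_gt0 : forall t, 1 <= t -> 0 < a t.
Hypothesis a_meas : measurable_fun `[(1 : R), +oo[ a.
Local Notation U := (tail_quantile F).
Hypothesis a_lim : ext_regularly_varying xi U a.

Lemma regularly_varying_auxiliary : regularly_varying xi a.
Proof.
split; last exact: auxiliary_ratio_cvg a_lim.
exists 1; split; last by move=> t /ltW; exact: a_gt0.
apply: measurable_funS a_meas; first exact: measurable_itv.
by apply: subset_itvr; rewrite bnd_simp.
Qed.

Lemma unbounded_quantile_ratio : right_endpoint F = +oo%E ->
  forall c, 0 < c -> U (c * t) / U t @[t --> +oo] --> c `^ xi.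
Proof.
move=> Fy; apply: ratio_cvg_gt0; first by apply: tail_quantile_near_gt; rewrite // Fy ltry.
move=> c c1; apply: (ext_rv_unbounded xi U a) => //.
- exact: tail_quantile_nd.
- by move=> t; exact: tail_quantile_ge0.
- exact: tail_quantile_cvgy.
Qed.

(** A nondecreasing positive function cannot satisfy U(2t)/U(t) -> 2^xi < 1. *)
Lemma unbounded_index_ge0 : right_endpoint F = +oo%E -> 0 <= xi.
Proof.
move=> Fy; rewrite leNgt; apply/negP => /powR2_lt1; apply/negP; rewrite -leNgt.
apply: (cvgr_to_ge (unbounded_quantile_ratio Fy 2 _)); first by [].
near=> t.
have t1 : 1 < t by near: t; apply: nbhs_pinfty_gt; exact: num_real.
rewrite ler_pdivlMr ?mul1r.
  by apply: tail_quantile_nd => //; lra.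
by near: t; apply: tail_quantile_near_gt; rewrite // Fy ltry.
Unshelve. all: by end_near. Qed.

Section Bounded.
Variable xs : R.
Hypothesis Fxs : right_endpoint F = xs%:E.
Hypothesis xs0 : 0 < xs.

Lemma bounded_quantile_ratio : (\forall t \near +oo, U t < xs) /\
  forall c, 1 < c -> (xs - U (c * t)) / (xs - U t) @[t --> +oo] --> c `^ xi.
Proof.
apply: (ext_rv_bounded xi U a) => //.
  move=> t t1; have := tail_quantile_le_endpoint F HF t.
  by rewrite Fxs; apply => //; rewrite ?ltry ?lte_fin.
by have := tail_quantile_cvg F HF; rewrite Fxs; apply; rewrite ?ltry ?lte_fin.
Qed.

Lemma bounded_index_le0 : xi <= 0.
Proof.
rewrite leNgt; apply/negP => /powR2_gt1; apply/negP; rewrite -leNgt.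
have [Uxs UL] := bounded_quantile_ratio.
apply: (cvgr_to_le (UL 2 _)); first lra.
near=> t.
have t1 : 1 < t by near: t; apply: nbhs_pinfty_gt; exact: num_real.
rewrite ler_pdivrMr ?mul1r.
  by rewrite lerD2l lerN2; apply: tail_quantile_nd => //; lra.
by rewrite subr_gt0; near: t.
Unshelve. all: by end_near. Qed.

Lemma bounded_ratio_auxiliary_cvg : xi != 0 ->
  (xs - U n%:R) / a n%:R @[n --> \oo] --> - xi^-1.
Proof.
move=> xi0; have [Uxs UL] := bounded_quantile_ratio.
have x1 : (2 : R) `^ xi != 1.
  by move: xi0; rewrite neq_lt => /orP[/powR2_lt1/lt_eqF->//|/powR2_gt1/gt_eqF->].
have H : (xs - U (t * 2) - (xs - U t)) / a t @[t --> +oo] --> - box_cox xi 2.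
  have H : - ((U (t * 2) - U t) / a t) @[t --> +oo] --> - box_cox xi 2.
    by apply: cvgN; apply: a_lim; lra.
  by apply: (cvg_near_eq _ _ _ H); near=> t; rewrite -mulNr; congr (_ / _); ring.
have K := ratio_auxiliary_cvg xi _ (fun t => xs - U t) a _ x1 (UL 2 ltac:(lra)) H.
rewrite (_ : - xi^-1 = - box_cox xi 2 / (2 `^ xi - 1)); last first.
  have b1 : 2 `^ xi - 1 != 0 by rewrite subr_eq0.
  by rewrite /box_cox (negbTE xi0); field; rewrite xi0 b1.
have /cvg_pinftyP : (xs - U t) / a t @[t --> +oo] --> - box_cox xi 2 / (2 `^ xi - 1).
  by apply: K; near=> t; rewrite gt_eqF// subr_gt0; near: t.
by apply; exact: cvgr_idn.
Unshelve. all: by end_near. Qed.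

End Bounded.

Lemma unbounded_ratio_auxiliary_cvg : right_endpoint F = +oo%E -> xi != 0 ->
  U n%:R / a n%:R @[n --> \oo] --> xi^-1.
Proof.
move=> Fy xi0.
have x1 : (2 : R) `^ xi != 1.
  by move: xi0; rewrite neq_lt => /orP[/powR2_lt1/lt_eqF->//|/powR2_gt1/gt_eqF->].
have K := ratio_auxiliary_cvg xi _ U a _ x1 (unbounded_quantile_ratio Fy 2 ltac:(lra))
  (a_lim 2 ltac:(lra)).
rewrite (_ : xi^-1 = box_cox xi 2 / (2 `^ xi - 1)); last first.
  have b1 : 2 `^ xi - 1 != 0 by rewrite subr_eq0.
  by rewrite /box_cox (negbTE xi0); field; rewrite xi0 b1.
have /cvg_pinftyP : U t / a t @[t --> +oo] --> box_cox xi 2 / (2 `^ xi - 1).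
  apply: K; near=> t; rewrite gt_eqF//; near: t.
  by apply: tail_quantile_near_gt; rewrite // Fy ltry.
by apply; exact: cvgr_idn.
Unshelve. all: by end_near. Qed.

End ExtendedRegularVariation.

(** * The theorem *)

Theorem theorem3p1 (R : realType) (d : measure_display) (T : measurableType d)
  (P : probability T R) (X : nat -> {RV P >-> R}) (F : R -> R) (xi : R)
  (a : R -> R)
  (X_indep : independent_seq X)
  (X_ident : identically_distributed X)
  (X_ge0 : forall i, {ae P, forall w, 0 <= X i w})
  (X_cdf : forall x, cdf (X 0%N) x = (F x)%:E)
  (endpoint_gt0 : (0 < right_endpoint F)%E)
  (EX_finite : ('E_P[X 0%N] < +oo)%E)
  (xi_lt1 : xi < 1)
  (F_MDA : MDA F (gev xi))
  (a_gt0 : forall t, 1 <= t -> 0 < a t)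
  (a_meas : measurable_fun `[(1 : R), +oo[ a)
  (a_lim : forall x, 0 < x ->
     (tail_quantile F (t * x) - tail_quantile F t) / a t @[t --> +oo]
       --> box_cox xi x) :
  let U := tail_quantile F in
  let xs := fine (right_endpoint F) in
  [/\ (* (i) *)
      0 < xi ->
        (forall x, 0 < x ->
           (((a n%:R)^-1)%:E * 'E_P[overshoot X n x])%E @[n --> \oo]
             --> (- (Gamma (- xi) / x))%:E) /\
        regularly_varying xi a,
      (* (ii) *)
      xi = 0 -> right_endpoint F = +oo%E ->
        (forall x, 0 < x ->
           (((U n%:R)^-1)%:E * 'E_P[overshoot X n x])%E @[n --> \oo]
             --> (x^-1)%:E) /\
        regularly_varying 0 U,
      (* (iii) *)
      xi = 0 -> (right_endpoint F < +oo)%E ->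
        (forall x, 0 < x -> x < xs ->
           (((xs - U n%:R)^-1)%:E *
             (((xs - x) / x)%:E - 'E_P[overshoot X n x]))%E @[n --> \oo]
             --> (x^-1)%:E /\
           (((xs - U n%:R)^-1)%:E * 'E_P[endpoint_gap X xs n x])%E
             @[n --> \oo] --> (xs^-1)%:E) /\
        exists L : R -> R,
          [/\ regularly_varying 0 L,
              forall t, 1 < t -> U t = xs - L t &
              L t @[t --> +oo] --> 0]
    & (* (iv) *)
      xi < 0 ->
        [/\ (right_endpoint F < +oo)%E,
            forall x, 0 < x -> x < xs ->
              (((a n%:R)^-1)%:E *
                (((xs - x) / x)%:E - 'E_P[overshoot X n x]))%E @[n --> \oo]
                --> (Gamma (- xi) / x)%:E /\
              (((a n%:R)^-1)%:E * 'E_P[endpoint_gap X xs n x])%E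
                @[n --> \oo] --> (Gamma (- xi) / xs)%:E
          & regularly_varying xi a]].
Proof.
move=> U xs.
have HF : nonneg_cdf F by exact: (nonneg_cdf_RV d T P X F X_ge0 X_cdf).
have HU : ext_regularly_varying xi U a by [].
have rv_a : regularly_varying xi a.
  exact: (regularly_varying_auxiliary F).
have U0 : right_endpoint F = +oo%E -> \forall t \near +oo, 0 < U t.
  by move=> Fy; apply: tail_quantile_near_gt; rewrite // Fy ltry.
have fin : (right_endpoint F < +oo)%E -> right_endpoint F = xs%:E.
  by move=> Fy; rewrite fineK// ge0_fin_numE// ltW.
have xs0 : (right_endpoint F < +oo)%E -> 0 < xs.
  by move=> Fy; rewrite fine_gt0// endpoint_gt0 Fy.
have mU : measurable_fun `](1 : R), +oo[ U by exact: measurable_tail_quantile.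
split.
- move=> xi0.
  have Fy : right_endpoint F = +oo%E.
    have [//|Fy] := eqVneq (right_endpoint F) +oo%E.
    have {}Fy : (right_endpoint F < +oo)%E by rewrite ltey.
    have := bounded_index_le0 F xi a HF a_gt0 HU xs (fin Fy) (xs0 Fy).
    by rewrite leNgt xi0.
  split=> // x x0.
  have -> : - (Gamma (- xi) / x) = xi^-1 * (gamma_integral (1 - xi) / x).
    by rewrite Gamma_oppE//; ring.
  apply: (rescale_cvg (fun n => U n%:R)).
  + by apply: (near_pinfty_nat (fun t => U t != 0)); near=> t; rewrite gt_eqF//; near: t; exact: U0.
  + by apply: (unbounded_ratio_auxiliary_cvg F xi a); rewrite // gt_eqF.
  + apply: (mean_overshoot_cvgy d T P X F X_indep X_ident X_ge0 X_cdf) => //.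
      exact: ltW.
    exact: (unbounded_quantile_ratio F xi a).
- move=> xi0 Fy; have UR := unbounded_quantile_ratio F xi a HF a_gt0 HU Fy.
  split; last first.
    rewrite xi0 in UR; split=> //.
    have [M [_ MP]] := U0 Fy; exists (Num.max M 1); split.
      apply: measurable_funS mU; first exact: measurable_itv.
      by apply: subset_itvr; rewrite bnd_simp le_max lexx orbT.
    by move=> t; rewrite gt_max => /andP[/MP].
  move=> x x0.
  have -> : x^-1 = gamma_integral (1 - xi) / x by rewrite xi0 subr0 gamma_integral_1 div1r.
  by apply: (mean_overshoot_cvgy d T P X F X_indep X_ident X_ge0 X_cdf) => //; rewrite xi0.
- move=> xi0 Fy; have Fxs := fin Fy; have x0s := xs0 Fy.
  have [Uxs UL] := bounded_quantile_ratio F xi a HF a_gt0 HU xs Fxs x0s.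
  split.
    move=> x x0 xxs.
    have H : ((xs - U n%:R)^-1%:E * (((xs - x) / x)%:E - 'E_P[overshoot X n x]))%E
        @[n --> \oo] --> (1 / x)%:E.
      have -> : 1 / x = gamma_integral (1 - xi) / x by rewrite xi0 subr0 gamma_integral_1.
      apply: (mean_deficit_cvg d T P X F X_indep X_ident X_ge0 X_cdf) => //.
      by rewrite xi0 lexx.
    split; first by rewrite div1r in H.
    rewrite -(div1r xs).
    exact: (mean_endpoint_gap_cvg d T P X F X_indep X_ident X_ge0 X_cdf xs Fxs x0s
      (fun n => xs - U n%:R) x 1 x0 xxs H).
  exists (fun t => xs - U t); split.
  + split; last first.
      apply: ratio_cvg_gt0; first by near=> t; rewrite subr_gt0; near: t.
      by rewrite -xi0.
    have [M [_ MP]] := Uxs; exists (Num.max M 1); split.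
      apply: measurable_funB => //; apply: measurable_funS mU; first exact: measurable_itv.
      by apply: subset_itvr; rewrite bnd_simp le_max lexx orbT.
    by move=> t; rewrite gt_max subr_gt0 => /andP[/MP].
  + by move=> t _; rewrite subKr.
  + rewrite -(subrr xs); apply: cvgB; first exact: cvg_cst.
    exact: tail_quantile_cvg.
- move=> xi0.
  have Fy : (right_endpoint F < +oo)%E.
    rewrite ltey; apply/negP => /eqP Fy.
    have := unbounded_index_ge0 F xi a HF a_gt0 HU Fy.
    by rewrite leNgt xi0.
  have Fxs := fin Fy; have x0s := xs0 Fy.
  have [Uxs UL] := bounded_quantile_ratio F xi a HF a_gt0 HU xs Fxs x0s.
  split=> // x x0 xxs.
  have H : ((a n%:R)^-1%:E * (((xs - x) / x)%:E - 'E_P[overshoot X n x]))%E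
      @[n --> \oo] --> (Gamma (- xi) / x)%:E.
    have nxi : 0 < - xi by rewrite oppr_gt0.
    have -> : Gamma (- xi) / x = - xi^-1 * (gamma_integral (1 - xi) / x).
      rewrite Gamma_gt0E// addrC gamma_integral_recl//; field.
      by rewrite gt_eqF// lt_eqF.
    apply: (rescale_cvg (fun n => xs - U n%:R)).
    + apply: (near_pinfty_nat (fun t => xs - U t != 0)); near=> t.
      by rewrite gt_eqF// subr_gt0; near: t.
    + by apply: (bounded_ratio_auxiliary_cvg F xi a); rewrite // lt_eqF.
    + apply: (mean_deficit_cvg d T P X F X_indep X_ident X_ge0 X_cdf) => //.
      exact: ltW.
  split=> //.
  exact: (mean_endpoint_gap_cvg d T P X F X_indep X_ident X_ge0 X_cdf xs Fxs x0s
      (fun n => a n%:R) x (Gamma (- xi)) x0 xxs H).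
Unshelve. all: by end_near. Qed.
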